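(* Let $b\ge 2$ be an integer, let $(\Omega,\mathcal A,\mathbb P)$ be a probability space, and let $X_1,X_2,\dots$ be random variables from $\Omega$ into $\{0,\dots,b-1\}$. (i) Assume that each $X_n$ is uniformly distributed on $\{0,\dots,b-1\}$, and that there is a function $g:\mathbb N\to\mathbb R$, monotonically increasing to $\infty$, such that for all sufficiently large $n$ the random variables $X_n, X_{n+1},\dots,X_{n+\lceil g(n)\log\log n\rceil}$ are mutually independent. Then $\mathbb P$-almost surely the real number $x=\sum_{j\ge1}X_jb^{-j}$ is normal to base $b$. (ii) Conversely, for every integer $b\ge2$ and every constant $K>0$ there exist a probability space and random variables $X_1,X_2,\dots$ with values in $\{0,\dots,b-1\}$ such that each $X_n$ is uniformly distributed on $\{0,\dots,b-1\}$, for all sufficiently large $n$ the random variables $X_n,X_{n+1},\dots,X_{n+\lceil K\log\log n\rceil}$ are mutually independent, but $\mathbb P$-almost surely the number $x=\sum_{j\ge1}X_jb^{-j}$ is not simply normal to base $b$.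
   Context: A real number is simply normal to base $b$ if each digit in $\{0,\dots,b-1\}$ occurs in its base-$b$ expansion with asymptotic frequency $1/b$; it is normal to base $b$ if it is simply normal to each of the bases $b,b^2,b^3,\dots$. *)

(* Defs.v *)
From HB Require Import structures.
From mathcomp Require Import all_boot all_order all_algebra finmap.
From mathcomp Require Import all_classical all_reals all_analysis.

Set Implicit Arguments.
Unset Strict Implicit.
Unset Printing Implicit Defensive.

Import Order.TTheory GRing.Theory Num.Theory.
Import numFieldNormedType.Exports.

Local Open Scope classical_set_scope.
Local Open Scope ring_scope.

(* The j-th digit after the radix point (j >= 1). A base-b rational gets its
   terminating expansion, and x < 0 gets the digits of -x. The finitely many
   digits of the integer part do not affect frequencies and are left out. *)
Definition digit (R : realType) (b : nat) (x : R) (j : nat) : nat :=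
  (Num.truncn (`|x| * b%:R ^+ j) %% b)%N.

Definition simply_normal (R : realType) (b : nat) (x : R) : Prop :=
  forall a : nat, (a < b)%N ->
    (count (fun j => digit b x j == a) (iota 1 n))%:R / n%:R
      @[n --> \oo] --> (b%:R^-1 : R).

Definition normal_number (R : realType) (b : nat) (x : R) : Prop :=
  forall k : nat, (0 < k)%N -> simply_normal (b ^ k) x.

Definition mutually_independent (d d' : measure_display) (T : measurableType d)
    (T' : measurableType d') (R : realType) (P : probability T R)
    (I : set nat) (X : nat -> {RV P >-> T'}) : Prop :=
  forall J : {fset nat}, [set` J] `<=` I ->
  forall A : nat -> set T', (forall j, measurable (A j)) ->
    P (\bigcap_(j in [set` J]) (X j @^-1` A j)) =
    (\prod_(j <- J) P (X j @^-1` A j))%E.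

Definition uniform_digit (d : measure_display) (T : measurableType d)
    (R : realType) (P : probability T R) (b : nat) (X : {RV P >-> nat}) : Prop :=
  forall a : nat, (a < b)%N -> distribution P X [set a] = (b%:R^-1)%:E.

(* {n, ..., n + ceil r}; the upper bound is compared in int because the
   ceiling can be negative. *)
Definition window (R : realType) (n : nat) (r : R) : set nat :=
  [set k | (n <= k)%N /\ (k%:Z <= n%:Z + Num.ceil r)%R].

(* Digits are indexed from 1; x 0 plays no role. *)
Definition number_of_digits (R : realType) (b : nat) (x : nat -> nat) : R :=
  \big[+%R/0]_(1 <= j <oo) ((x j)%:R / b%:R ^+ j : R).

(* Main.v *)
Require Import Defs.
From HB Require Import structures.
From mathcomp Require Import all_boot all_order all_algebra finmap.
From mathcomp Require Import all_classical all_reals all_analysis measurable_realfun.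
From mathcomp Require Import zify ring lra.

Set Implicit Arguments.
Unset Strict Implicit.
Unset Printing Implicit Defensive.

Import Order.TTheory GRing.Theory Num.Theory.
Import numFieldNormedType.Exports.

Local Open Scope classical_set_scope.
Local Open Scope ring_scope.

(** For (i), fix [k] and a value [c] of a group of [k] digits. On the dyadic
    range [2 ^ i, 2 ^ (i + 1)) the hypothesis makes [C ln i] consecutive groups
    independent for any constant [C], so by Chernoff's bound the average over
    such a window is off by more than [e] with probability [O(i ^ -2)]. By
    Markov's inequality and Borel-Cantelli, almost surely the windows with a bad
    average have vanishing density in the dyadic ranges, although different
    windows may depend on each other.

    For (ii), on [2 ^ i, 2 ^ (i + 1)) repeat periodically a block of about
    [M log i] independent digits. A block has a letter with frequency at least
    [1 / b + (1 - 1 / b) / M] with probability at least [1 / (b i)]: complete an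
    arbitrary word by [log_b i] copies of its most frequent letter. The blocks
    are independent and the harmonic series diverges, so this happens infinitely
    often. The independent digits are those of a uniform point of [0, 1]. *)

(** * Digits of a number *)

(** Keeping the partial sums as integers turns the extraction of digits into division and remainder
    by powers of [b]. *)
Fixpoint prefix_value (b : nat) (x : nat -> nat) (n : nat) : nat :=
  if n is n'.+1 then (b * prefix_value b x n' + x n'.+1)%N else 0%N.

Lemma prefix_value_lt b x n : (0 < b)%N ->
  (forall j, (0 < j)%N -> (x j < b)%N) -> (prefix_value b x n < b ^ n)%N.
Proof.
move=> b0 xb; elim: n => [|n IH] //=; rewrite expnS.
have := xb n.+1 isT; nia.
Qed.

Lemma partial_sum_prefix_value (R : realType) b x n : (0 < b)%N ->
  \sum_(1 <= j < n.+1) ((x j)%:R / b%:R ^+ j : R) =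
  (prefix_value b x n)%:R / b%:R ^+ n.
Proof.
move=> b0; have bn0 : b%:R != 0 :> R by rewrite pnatr_eq0 -lt0n.
elim: n => [|n IH]; first by rewrite big_geq // mul0r.
rewrite big_nat_recr //= IH natrD natrM exprS.
by field; rewrite bn0 expf_neq0.
Qed.

Lemma lower_prefix_nd (R : realType) b x : (0 < b)%N ->
  {homo (fun n => (prefix_value b x n)%:R / b%:R ^+ n : R) :
    m n / (m <= n)%N >-> m <= n}.
Proof.
move=> b0; apply/nondecreasing_seqP => n /=.
have b0' : 0 < b%:R :> R by rewrite ltr0n.
rewrite exprS invfM mulrA ler_pM2r ?invr_gt0 ?exprn_gt0//.
by rewrite ler_pdivlMr// natrD natrM mulrC lerDl.
Qed.

(** Since [x n.+1 < b], the next prefix plus one is at most [b] times the present prefix plus one.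
    With [lower_prefix_nd] this gives nested intervals around the number. *)
Lemma upper_prefix_ni (R : realType) b x : (0 < b)%N ->
  (forall j, (0 < j)%N -> (x j < b)%N) ->
  {homo (fun n => (prefix_value b x n).+1%:R / b%:R ^+ n : R) :
    m n / (m <= n)%N >-> n <= m}.
Proof.
move=> b0 xb; apply/nonincreasing_seqP => n /=.
have b0' : 0 < b%:R :> R by rewrite ltr0n.
rewrite exprS invfM mulrA ler_pM2r ?invr_gt0 ?exprn_gt0//.
rewrite ler_pdivrMr// -natrM ler_nat.
by have := xb n.+1 isT; nia.
Qed.

Lemma prefix_value_cvg (R : realType) b x : (0 < b)%N ->
  (forall j, (0 < j)%N -> (x j < b)%N) ->
  (prefix_value b x n)%:R / b%:R ^+ n @[n --> \oo] --> number_of_digits R b x.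
Proof.
move=> b0 xb; have b0' : 0 < b%:R :> R by rewrite ltr0n.
have C : cvgn (fun n => (prefix_value b x n)%:R / b%:R ^+ n : R).
  apply: nondecreasing_is_cvgn; first exact: lower_prefix_nd.
  exists 1 => _ [n _ <-]; rewrite ler_pdivrMr ?exprn_gt0// mul1r -natrX ler_nat.
  exact/ltnW/prefix_value_lt.
have -> : number_of_digits R b x =
    limn (fun n => (prefix_value b x n)%:R / b%:R ^+ n : R); last exact: C.
rewrite /number_of_digits; apply: cvg_lim => //.
(* The series is summed over [j < n]; after the shift its partial sum uses exactly the first [n]
   digits. *)
rewrite -cvg_shiftS.
under eq_fun do rewrite partial_sum_prefix_value//.
exact: C.
Qed.

Lemma lower_prefix_le (R : realType) b x n : (0 < b)%N ->
  (forall j, (0 < j)%N -> (x j < b)%N) ->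
  (prefix_value b x n)%:R / b%:R ^+ n <= number_of_digits R b x.
Proof.
move=> b0 xb; have /cvg_lim <- // := @prefix_value_cvg R b x b0 xb.
apply: nondecreasing_cvgn_le; first exact: lower_prefix_nd.
by apply/cvg_ex; eexists; exact: prefix_value_cvg.
Qed.

Lemma upper_prefix_ge (R : realType) b x n : (0 < b)%N ->
  (forall j, (0 < j)%N -> (x j < b)%N) ->
  number_of_digits R b x <= (prefix_value b x n).+1%:R / b%:R ^+ n.
Proof.
move=> b0 xb; have C := @prefix_value_cvg R b x b0 xb.
have b0' : 0 < b%:R :> R by rewrite ltr0n.
rewrite -(cvg_lim _ C)//; apply: limr_le; first by apply/cvg_ex; eexists; exact: C.
exists n => // m /= nm; apply: le_trans (@upper_prefix_ni R b x b0 xb _ _ nm).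
by rewrite ler_pM2r ?invr_gt0 ?exprn_gt0// ler_nat.
Qed.

Lemma number_of_digits_ge0 (R : realType) b x : (0 < b)%N ->
  (forall j, (0 < j)%N -> (x j < b)%N) -> 0 <= number_of_digits R b x.
Proof.
by move=> b0 xb; apply: le_trans (@lower_prefix_le R b x 0 b0 xb); rewrite mul0r.
Qed.

(** The number lies in the closed interval between the lower and the upper prefix bound. A later
    digit other than [b - 1] makes the upper bound drop strictly, which excludes the right end.
    Expansions ending in [b - 1] forever are treated in [digit_eventually_max]. *)
Lemma truncn_number_of_digits (R : realType) b x n : (0 < b)%N ->
  (forall j, (0 < j)%N -> (x j < b)%N) ->
  (forall N, exists2 j, (N <= j)%N & (x j.+1).+1 != b) ->
  Num.truncn (number_of_digits R b x * b%:R ^+ n) = prefix_value b x n.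
Proof.
move=> b0 xb io; have b0' : 0 < b%:R :> R by rewrite ltr0n.
apply: truncn_def; rewrite -ler_pdivrMr ?exprn_gt0// lower_prefix_le//=.
rewrite -ltr_pdivlMr ?exprn_gt0//; have [j nj xj] := io n.
apply: le_lt_trans (@upper_prefix_ge R b x j.+1 b0 xb) _.
apply: lt_le_trans (@upper_prefix_ni R b x b0 xb _ _ nj).
rewrite exprS invfM mulrA ltr_pM2r ?invr_gt0 ?exprn_gt0//.
rewrite ltr_pdivrMr// -natrM ltr_nat /=.
by have := xb j.+1 isT; nia.
Qed.

Lemma digit_number_of_digits (R : realType) b x k j : (0 < b)%N ->
  (forall j, (0 < j)%N -> (x j < b)%N) ->
  (forall N, exists2 j, (N <= j)%N & (x j.+1).+1 != b) ->
  digit (b ^ k) (number_of_digits R b x) j =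
  (prefix_value b x (k * j) %% b ^ k)%N.
Proof.
move=> b0 xb io; rewrite /digit ger0_norm ?number_of_digits_ge0//.
by rewrite natrX -exprM truncn_number_of_digits.
Qed.

Lemma digit_eventually_max (R : realType) b x N j : (1 < b)%N ->
  (forall j, (0 < j)%N -> (x j < b)%N) ->
  (forall j, (N <= j)%N -> (x j.+1).+1 = b) ->
  (N < j)%N -> digit b (number_of_digits R b x) j = 0%N.
Proof.
move=> b1 xb ev Nj; have b0 := ltnW b1; have b0' : 0 < b%:R :> R by rewrite ltr0n.
(* From [N] on the upper prefix bound is constant, and the number equals it: it is a rational with a
   terminating expansion. *)
have E n : (N <= n)%N ->
    (prefix_value b x n).+1 = ((prefix_value b x N).+1 * b ^ (n - N))%N.
  elim: n => [|n IH]; first by rewrite leqn0 => /eqP ->; rewrite muln1.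
  rewrite leq_eqVlt => /orP[/eqP <-|]; first by rewrite subnn muln1.
  rewrite ltnS => Nn; rewrite subSn// expnS /= -addnS ev// -mulnSr IH//; lia.
have -> : number_of_digits R b x = (prefix_value b x N).+1%:R / b%:R ^+ N.
  apply/eqP; rewrite eq_le upper_prefix_ge//=; apply/ler_addgt0Pr => e e0.
  have [n Nn He] : exists2 n, (N <= n)%N & (b%:R ^+ n)^-1 <= e :> R.
    exists (maxn N (Num.truncn e^-1).+1); first exact: leq_maxl.
    rewrite invf_ple ?posrE ?exprn_gt0//; apply/ltW/(lt_le_trans (truncnS_gt _)).
    rewrite -natrX ler_nat; apply: leq_trans (leq_maxr N _) _.
    by apply/ltnW/ltn_expl.
  have -> : (prefix_value b x N).+1%:R / b%:R ^+ N =
      (prefix_value b x n).+1%:R / b%:R ^+ n :> R.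
    have -> : b%:R ^+ n = b%:R ^+ (n - N) * b%:R ^+ N :> R.
      by rewrite -exprD subnK.
    by rewrite (E n Nn) natrM natrX; field; rewrite !expf_neq0 ?gt_eqF.
  rewrite -natr1 mulrDl mul1r; apply: lerD => //; exact: lower_prefix_le.
rewrite /digit ger0_norm; last by rewrite divr_ge0 ?exprn_ge0 ?ltW.
rewrite -(subnK (ltnW Nj)) exprD mulrA -[b%:R ^+ (j - N)]natrX.
rewrite mulrAC divfK ?expf_neq0 ?gt_eqF//.
rewrite -natrM natrK -(subnSK Nj) expnS mulnCA; exact: modnMr.
Qed.

Lemma prefix_value_mod b x n : (x n.+1 < b)%N ->
  (prefix_value b x n.+1 %% b)%N = x n.+1.
Proof. by move=> xb; rewrite /= mulnC modnMDl modn_small. Qed.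

Lemma count_finite_freq0 (R : realType) (p : pred nat) N :
  (forall j, (N < j)%N -> ~~ p j) ->
  (count p (iota 1 n))%:R / n%:R @[n --> \oo] --> (0 : R).
Proof.
move=> Hp; apply: (@squeeze_cvgr _ _ _ _ (cst 0) (fun n => N.+1%:R * n%:R^-1)).
- apply: nearW => n; rewrite divr_ge0//= ler_wpM2r ?invr_ge0// ler_nat.
  rewrite -size_filter -[leqRHS](size_iota 0); apply: uniq_leq_size.
    exact/filter_uniq/iota_uniq.
  move=> j; rewrite mem_filter => /andP[pj _]; rewrite mem_iota /= add0n ltnS.
  by rewrite leqNgt; apply/negP => /Hp; rewrite pj.
- exact: cvg_cst.
- rewrite -(mulr0 N.+1%:R); apply: cvgMl_tmp.
  by rewrite -cvg_shiftS; exact: cvg_harmonic.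
Qed.

(** Passes from the digits of the real number to the given sequence. They agree unless the sequence
    ends in [b - 1] forever, and then the number is not simply normal. *)
Lemma simply_normal_digits (R : realType) b x a : (1 < b)%N ->
  (forall j, (0 < j)%N -> (x j < b)%N) ->
  simply_normal b (number_of_digits R b x) -> (a < b)%N ->
  (count (fun j => x j == a) (iota 1 n))%:R / n%:R @[n --> \oo] --> (b%:R^-1 : R).
Proof.
move=> b1 xb SN ab; have b0 := ltnW b1.
case: (pselect (forall N, exists2 j, (N <= j)%N & (x j.+1).+1 != b)) => [io|].
  under eq_fun => n.
    have -> : count (fun j => x j == a) (iota 1 n) =
        count (fun j => digit b (number_of_digits R b x) j == a) (iota 1 n).
      apply: eq_in_count => -[|j]; rewrite mem_iota// => _.
      have := @digit_number_of_digits R b x 1 j.+1 b0 xb io.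
      by rewrite !expn1 mul1n => ->; rewrite prefix_value_mod// xb.
    over.
  exact: SN.
move/existsNP => [N HN].
have ev j : (N <= j)%N -> (x j.+1).+1 = b.
  by move=> Nj; apply: contra_notP HN => /eqP ?; exists j.
(* The digits of the number are eventually 0, so the digit 1, which exists because [1 < b], has
   frequency 0. *)
exfalso; have := SN 1%N b1.
have c0 : (count (fun j => digit b (number_of_digits R b x) j == 1%N) (iota 1 n))%:R
    / n%:R @[n --> \oo] --> (0 : R).
  apply: (@count_finite_freq0 _ _ N) => j Nj.
  by rewrite (digit_eventually_max R b1 xb ev Nj).
move=> /(cvg_unique _ c0) h; have /eqP := h (@Rhausdorff R).
by rewrite eq_sym invr_eq0 pnatr_eq0 -leqn0 leqNgt b0.
Qed.

(** * Chernoff's bound and dyadic averages *)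

(** From [1 - x <= expR (- x)] one gets [(1 - x) * expR x <= 1], while [(1 - x) (1 + x + 2 x^2) = 1
    + x^2 (1 - 2 x)] is at least 1. *)
Lemma expR_le_quadratic (R : realType) (x : R) : x <= 2^-1 ->
  expR x <= 1 + x + 2 * x ^+ 2.
Proof.
move=> x2; have := expR_ge1Dx (- x); rewrite expRN => h.
have e0 := expR_gt0 x.
have h' : (1 - x) * expR x <= 1 by rewrite -ler_pdivlMr// div1r.
have : 0 <= (1 - x) by lra.
nra.
Qed.

(** The counting form of the factorisation of the moment generating function of a sum of independent
    variables. *)
Lemma sum_expR_ffun (R : realType) (m q : nat) (Y : 'I_q -> R) (t : R) :
  \sum_(f : {ffun 'I_m -> 'I_q}) expR (t * \sum_i Y (f i)) =
  (\sum_u expR (t * Y u)) ^+ m.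
Proof.
rewrite -[m in RHS]card_ord -prodr_const bigA_distr_bigA /=.
by apply: eq_bigr => f _; rewrite mulr_sumr expR_sum.
Qed.

(** Exponential Markov inequality for the counting measure: every counted word contributes at least
    [expR (t * (e * m))] to the sum in [sum_expR_ffun]. *)
Lemma chernoff_count_upper (R : realType) (m q : nat) (Y : 'I_q -> R) (e : R) :
  (forall u, `|Y u| <= 1) -> \sum_u Y u = 0 -> 0 <= e <= 2 ->
  #|[pred f : {ffun 'I_m -> 'I_q} | e * m%:R <= \sum_i Y (f i)]|%:R <=
    expR (- (e ^+ 2 / 8) * m%:R) * q%:R ^+ m.
Proof.
move=> Y1 Y0 /andP[e0 e2].
set B := [pred f : {ffun 'I_m -> 'I_q} | e * m%:R <= \sum_i Y (f i)].
(* This [t] minimises [2 t^2 - t e], with minimum [- e^2 / 8]. The bound [e <= 2] keeps [t * Y u]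
   below [1 / 2], as the quadratic bound requires. *)
set t := e / 4.
have Ht : \sum_u expR (t * Y u) <= expR (2 * t ^+ 2) * q%:R.
  apply: (@le_trans _ _ (\sum_(u < q) (1 + t * Y u + 2 * t ^+ 2))).
    apply: ler_sum => u _; have := Y1 u; rewrite ler_norml => /andP[h1 h2].
    have ht : 0 <= t <= 2^-1 by rewrite /t; lra.
    apply: (le_trans (expR_le_quadratic _)); first by nra.
    rewrite lerD2l ler_pM2l// exprMn ler_piMr// ?sqr_ge0//.
    by rewrite -[leRHS](expr1n _ 2) -real_normK ?num_real// lerXn2r ?nnegrE.
  rewrite !big_split /= -mulr_sumr Y0 mulr0 addr0 !sumr_const card_ord.
  rewrite -mulrnDl -[leLHS]mulr_natr ler_wpM2r// addrC.
  by rewrite addrC expR_ge1Dx.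
have H : #|B|%:R * expR (t * (e * m%:R)) <= (expR (2 * t ^+ 2) * q%:R) ^+ m.
  apply: (@le_trans _ _ ((\sum_u expR (t * Y u)) ^+ m)); last first.
    by apply: lerXn2r => //; rewrite nnegrE ?mulr_ge0 ?expR_ge0 ?sumr_ge0// => *;
      exact: expR_ge0.
  rewrite -sum_expR_ffun (bigID (mem B)) /= -[leLHS]addr0; apply: lerD; last first.
    by apply: sumr_ge0 => *; exact: expR_ge0.
  rewrite mulr_natl -sumr_const; apply: ler_sum => f; rewrite inE => fB.
  by rewrite ler_expR ler_wpM2l// /t divr_ge0.
rewrite -(ler_pM2r (expR_gt0 (t * (e * m%:R)))); apply: le_trans H _.
rewrite exprMn mulrAC ler_wpM2r ?exprn_ge0// -expRD -expRM_natr ler_expR.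
rewrite /t; lra.
Qed.

(** The factor 2 comes from applying the one-sided bound to the centred indicator of [c] and to its
    opposite. *)
Lemma chernoff_count (R : realType) (m q : nat) (c : 'I_q) (e : R) :
  0 <= e <= 2 ->
  #|[pred f : {ffun 'I_m -> 'I_q} |
      e * m%:R <= `| \sum_i ((f i == c)%:R - q%:R^-1) |]|%:R <=
    2 * expR (- (e ^+ 2 / 8) * m%:R) * q%:R ^+ m.
Proof.
move=> he; have q0 : (0 < q)%N by case: (c) => i; exact: leq_ltn_trans.
have Y0 : \sum_(u < q) ((u == c)%:R - q%:R^-1) = 0 :> R.
  rewrite sumrB (bigD1 c)//= eqxx big1 ?addr0; last by move=> i /negbTE ->.
  by rewrite sumr_const card_ord -[X in _ - X]mulr_natr mulVf ?subrr// pnatr_eq0 -lt0n.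
have q1 : 0 <= (q%:R^-1 : R) <= 1 by rewrite invr_ge0 ler0n invf_le1 ?ler1n ?ltr0n.
have Y1 u : `|(u == c)%:R - q%:R^-1| <= 1 :> R.
  by rewrite ler_norml; case: eqP => _ /=; lra.
have U := chernoff_count_upper m Y1 Y0 he.
have L : #|[pred f : {ffun 'I_m -> 'I_q} |
      e * m%:R <= \sum_i (- ((f i == c)%:R - q%:R^-1))]|%:R <=
    expR (- (e ^+ 2 / 8) * m%:R) * q%:R ^+ m :> R.
  apply: (@chernoff_count_upper _ _ _ (fun u => - ((u == c)%:R - q%:R^-1))) => //.
    by move=> u; rewrite normrN.
  by rewrite sumrN Y0 oppr0.
rewrite -mulrA [2]mulr2n mulrDl mul1r; apply: le_trans (lerD U L).
rewrite -natrD ler_nat; rewrite -cardUI; apply: leq_trans (leq_addr _ _).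
apply/subset_leq_card/fintype.subsetP => f; rewrite !inE sumrN lerNr.
by rewrite lerNr ler_normr.
Qed.

(** Each shift by one removes one term and adds one, hence changes the sum by at most 2. *)
Lemma shifted_sum_dist (R : realType) (y : nat -> R) a N t :
  (forall j, `|y j| <= 1) -> (a <= N)%N ->
  `|\sum_(a <= j < N) y j - \sum_(a <= j < N) y (j + t)%N| <= 2 * t%:R.
Proof.
move=> y1 aN; elim: t => [|t IH].
  by under [X in _ - X]eq_bigr do rewrite addn0; rewrite subrr normr0 mulr0.
rewrite -[t.+1%:R]natr1 mulrDr mulr1 -(subrKA (\sum_(a <= j < N) y (j + t)%N)).
apply: le_trans (ler_normD _ _) _; apply: lerD => //.
rewrite -sumrB; under eq_bigr do rewrite addnS -addSn -opprB.
rewrite sumrN (telescope_sumr (fun j => y (j + t)%N))//= normrN.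
by apply: le_trans (ler_normB _ _) _; rewrite [2]mulr2n lerD.
Qed.

(* Replacing each term by the average of the [m] terms that start there changes
   the sum by at most [2 m], so only the windows with a large average matter. *)
Lemma sum_le_bad_windows (R : realType) (y : nat -> R) m a N (e : R)
    (bad : nat -> bool) :
  (forall j, `|y j| <= 1) -> (0 < m)%N -> (a <= N)%N -> 0 <= e ->
  (forall j, (a <= j < N)%N -> ~~ bad j -> `|\sum_(t < m) y (j + t)%N| <= e * m%:R) ->
  `|\sum_(a <= j < N) y j| <=
    2 * m%:R + e * (N - a)%:R + \sum_(a <= j < N) (bad j)%:R.
Proof.
move=> y1 m0 aN e0 good; have m0' : 0 < m%:R :> R by rewrite ltr0n.
rewrite -(ler_pM2l m0') -{1}(gtr0_norm m0') -normrM.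
have -> : m%:R * \sum_(a <= j < N) y j =
    \sum_(t < m) (\sum_(a <= j < N) y j - \sum_(a <= j < N) y (j + t)%N) +
    \sum_(a <= j < N) \sum_(t < m) y (j + t)%N.
  by rewrite [X in _ = _ + X]exchange_big /= -big_split /=;
     under [RHS]eq_bigr do rewrite subrK; rewrite sumr_const card_ord mulr_natl.
apply: le_trans (ler_normD _ _) _; rewrite -addrA mulrDr; apply: lerD.
  apply: le_trans (ler_norm_sum _ _ _) _.
  apply: (@le_trans _ _ (\sum_(t < m) 2 * m%:R)).
    apply: ler_sum => t _; apply: le_trans (shifted_sum_dist _ y1 aN) _.
    by rewrite ler_pM2l// ler_nat ltnW.
  by rewrite sumr_const card_ord -[leLHS]mulr_natl.
apply: le_trans (ler_norm_sum _ _ _) _.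
have -> : e * (N - a)%:R = \sum_(a <= j < N) e.
  by rewrite big_const_nat iter_addr_0 mulr_natr.
rewrite -big_split mulr_sumr /= big_nat [leRHS]big_nat; apply: ler_sum => j jaN.
case: (boolP (bad j)) => hb.
  apply: le_trans (ler_norm_sum _ _ _) _.
  apply: (@le_trans _ _ (\sum_(t < m) 1)); first by apply: ler_sum.
  by rewrite sumr_const card_ord ler_peMr// lerDr.
by rewrite addr0 mulrC good.
Qed.

(** The sum is cut at [2 ^ I] and at the largest power [2 ^ i <= n + 1]. The complete dyadic ranges
    between them add up geometrically to at most [e' * 2 ^ i]. *)
Lemma cesaro_dyadic (R : realType) (y : nat -> R) :
  (forall j, `|y j| <= 1) ->
  (forall e : R, 0 < e -> \forall i \near \oo, forall N,
     (2 ^ i <= N <= 2 ^ i.+1)%N -> `|\sum_(2 ^ i <= j < N) y j| <= e * (2 ^ i)%:R) ->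
  (\sum_(1 <= j < n.+1) y j) / n%:R @[n --> \oo] --> (0 : R).
Proof.
move=> y1 H; apply/cvgrPdist_le => e e0.
(* One fifth of [e] is for the initial segment, and two fifths each for the complete ranges and for
   the last partial one, as [2 ^ i <= n + 1 <= 2 n]. *)
have e5 : 0 < e / 5 by rewrite divr_gt0.
have [I _ HI] := H _ e5; set e' := e / 5 in e5 HI.
have S i : (I <= i)%N -> `|\sum_(2 ^ I <= j < 2 ^ i) y j| <= e' * (2 ^ i)%:R.
  elim: i => [|i IH].
    by rewrite leqn0 => /eqP ->; rewrite big_geq// normr0 mulr_ge0// ltW.
  rewrite leq_eqVlt => /orP[/eqP <-|].
    by rewrite big_geq// normr0 mulr_ge0// ltW.
  rewrite ltnS => Ii; rewrite (@big_cat_nat _ _ _ (2 ^ i)%N)/= ?leq_exp2l//.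
  apply: le_trans (ler_normD _ _) _.
  rewrite [X in _ <= _ * X%:R]expnS mul2n -addnn natrD mulrDr; apply: lerD; first exact: IH.
  by apply: HI => //=; rewrite leqnn leq_exp2l// leqnSn.
near=> n; rewrite sub0r normrN normrM normfV (@ger0_norm _ n%:R)//.
have n0 : (0 < n)%N by near: n; exists 1%N.
rewrite ler_pdivrMr ?ltr0n//.
have In : (2 ^ I <= n)%N by near: n; exists (2 ^ I)%N.
pose i := trunc_log 2 n.+1.
have /andP[i1 i2] := trunc_log_bounds (isT : 1 < 2)%N (ltn0Sn n).
rewrite -/i in i1 i2.
have Ii : (I <= i)%N by apply: trunc_log_max => //; exact: leqW.
have I1 : (1 <= 2 ^ I)%N by rewrite expn_gt0.
rewrite (@big_cat_nat _ _ _ (2 ^ I)%N)/= ?leqW//.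
rewrite (@big_cat_nat _ _ _ (2 ^ i)%N (2 ^ I)%N)/= ?leq_exp2l//.
have h1 : `|\sum_(1 <= j < 2 ^ I) y j| <= (2 ^ I)%:R.
  apply: le_trans (ler_norm_sum _ _ _) _.
  apply: (@le_trans _ _ (\sum_(1 <= j < 2 ^ I) 1)); first exact: ler_sum.
  by rewrite big_const_nat iter_addr_0 ler_nat leq_subr.
have h2 := S i Ii.
have h3 : `|\sum_(2 ^ i <= j < n.+1) y j| <= e' * (2 ^ i)%:R.
  by apply: HI => //=; rewrite i1 ltnW.
have h4 : (2 ^ i)%:R <= n%:R + 1 :> R by rewrite natr1 ler_nat.
have h5 : (2 ^ I)%:R <= e' * n%:R.
  rewrite mulrC -ler_pdivrMr//.
  near: n; exists (Num.truncn ((2 ^ I)%:R / e')).+1 => // n /= hn.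
  by apply/ltW/(lt_le_trans (truncnS_gt _)); rewrite ler_nat.
have h6 : 1 <= n%:R :> R by rewrite ler1n.
apply: le_trans (ler_normD _ _) _.
have := ler_normD (\sum_(2 ^ I <= j < 2 ^ i) y j) (\sum_(2 ^ i <= j < n.+1) y j).
have : e = 5 * e' by rewrite /e'; field.
move: h1 h2 h3 h4 h5 h6 e5.
clearbody e'; clear -e0.
set A := `|_|; set B := `|_|; set C := `|_|; set D := `|_ + _|.
set p := (2 ^ i)%:R; set q := (2 ^ I)%:R; set nn := n%:R.
move=> *; nra.
Unshelve. all: by end_near.
Qed.

(** * Part (i) *)

Lemma prefix_value_div b x n s : (0 < b)%N ->
  (forall j, (0 < j)%N -> (x j < b)%N) -> (s <= n)%N ->
  (prefix_value b x n %/ b ^ s)%N = prefix_value b x (n - s).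
Proof.
move=> b0 xb; elim: s n => [|s IH] n; first by rewrite divn1 subn0.
case: n => // n; rewrite ltnS => sn; rewrite subSS expnS divnMA /=.
by rewrite mulnC divnMDl// (divn_small (xb n.+1 isT)) addn0 IH.
Qed.

(* [prefix_value b x (k * j) %% b ^ k] encodes the [j]-th group of [k] digits. *)
Lemma digit_of_group b x k j s : (0 < b)%N ->
  (forall j, (0 < j)%N -> (x j < b)%N) -> (s < k)%N -> (0 < j)%N ->
  x (k * j - s)%N = ((prefix_value b x (k * j) %% b ^ k) %/ b ^ s %% b)%N.
Proof.
move=> b0 xb sk j0; have kj : (s < k * j)%N by nia.
rewrite modn_divl -expnS modn_dvdm; last exact: dvdn_exp2l.
rewrite expnS -modn_divl prefix_value_div// 1?ltnW//.
have -> : (k * j - s = (k * j - s).-1.+1)%N by lia.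
by rewrite prefix_value_mod// xb.
Qed.

(** * Probability of bad windows *)

Lemma measure_bigsetU_le d (T : measurableType d) (R : realType)
    (P : probability T R) (I : finType) (Q : pred I) (A : I -> set T) :
  (forall i, measurable (A i)) ->
  measurable (\big[setU/set0]_(i | Q i) A i) /\
  (P (\big[setU/set0]_(i | Q i) A i) <= \sum_(i | Q i) P (A i))%E.
Proof.
move=> mA; elim/big_rec2: _ => [|i s U _ [mU le]]; first by rewrite measure0.
split; first exact: measurableU.
by apply: le_trans (measureU2 _ _ _) _ => //; rewrite leeD2l.
Qed.

Lemma cylinder_prob (R : realType) b d (T : measurableType d)
    (P : probability T R) (X : nat -> {RV P >-> nat}) (I : set nat) n l
    (a : nat -> nat) :
  (forall n, (1 <= n)%N -> uniform_digit b (X n)) -> (0 < n)%N ->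
  mutually_independent I X ->
  (forall p, (n <= p < n + l)%N -> I p) -> (forall p, (a p < b)%N) ->
  P (\bigcap_(p in [set` seq_fset tt (iota n l)]) (X p @^-1` [set a p])) =
  ((b%:R^-1) ^+ l)%:E.
Proof.
move=> uX n0 indX In ab; rewrite indX; last by [].
  rewrite (eq_big_seq (fun=> (b%:R^-1)%:E)); last first.
    move=> p; rewrite seq_fsetE mem_iota => /andP[np _].
    by have := uX p (leq_trans n0 np) (a p) (ab p).
  rewrite prodEFin big_const_seq count_predT iter_mulr mulr1.
  by rewrite size_seq_fset undup_id ?iota_uniq// size_iota.
move=> p hp; apply: In; rewrite -mem_iota -(seq_fsetE tt); exact: hp.
Qed.

(** The [m] groups from [j0] on fill the digit positions from [k * (j0 - 1) + 1] to
    [k * (j0 - 1 + m)]. [B] is the union of the cylinders of all words of groups with a bad average;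
    each has probability [b ^ - (k m)], and [chernoff_count] bounds their number. *)
Lemma bad_window_cover (R : realType) b d (T : measurableType d)
    (P : probability T R) (X : nat -> {RV P >-> nat}) (I : set nat) k m j0
    (c : 'I_(b ^ k)) (e : R) :
  (0 < b)%N -> (forall n w, (1 <= n)%N -> (X n w < b)%N) ->
  (forall n, (1 <= n)%N -> uniform_digit b (X n)) ->
  (0 < k)%N -> (0 < j0)%N -> mutually_independent I X ->
  (forall p, (k * j0.-1 < p <= k * (j0.-1 + m))%N -> I p) -> 0 <= e <= 2 ->
  exists B, [/\ measurable B,
    (P B <= (2 * expR (- (e ^+ 2 / 8) * m%:R))%:E)%E
  & forall w, ~ B w ->
      `|\sum_(t < m) ((prefix_value b (X^~ w) (k * (j0 + t)) %% b ^ k == c)%N%:R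
         - (b ^ k)%:R^-1)| <= e * m%:R].
Proof.
move=> b0 Xb uX k0 j00 indX Ip he; set q := (b ^ k)%N.
have q0 : (0 < q)%N by rewrite expn_gt0 b0.
(* [fn] extends a word by 0 outside the window. [a f p] is the digit that [f] prescribes at position
   [p]: this position lies in group [j], with [k * j - p] digits of the group to its right. *)
pose fn (f : {ffun 'I_m -> 'I_q}) t : nat :=
  oapp (fun t' : 'I_m => f t' : nat) 0%N (insub t).
pose a f p : nat := let j := (p.-1 %/ k).+1 in
  (fn f (j - j0) %/ b ^ (k * j - p) %% b)%N.
pose n := (k * j0.-1).+1.
pose C f := \bigcap_(p in [set` seq_fset tt (iota n (k * m))])
  (X p @^-1` [set a f p]).
have PC f : P (C f) = ((b%:R^-1) ^+ (k * m))%:E.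
  apply: (@cylinder_prob R b _ _ P X I) => //.
    by move=> p np; apply: Ip; rewrite /n in np; nia.
  by move=> p; rewrite ltn_pmod.
have mC f : measurable (C f).
  apply: bigcap_measurableType => p _; exact: measurable_funPTI.
pose Q := [pred f : {ffun 'I_m -> 'I_q} |
      e * m%:R <= `| \sum_i ((f i == c)%:R - q%:R^-1) |].
have [mU leU] := @measure_bigsetU_le _ _ _ P _ Q C mC.
exists (\big[setU/set0]_(f | Q f) C f); split => //.
  apply: (le_trans leU).
  rewrite (eq_bigr (fun=> ((b%:R^-1) ^+ (k * m))%:E)) => [|f _]; last exact: PC.
  rewrite sumEFin lee_fin sumr_const -[leLHS]mulr_natl exprVn.
  rewrite ler_pdivrMr ?exprn_gt0 ?ltr0n// exprM -natrX.
  exact: (chernoff_count m c he).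
(* A point with a bad average lies in the cylinder of the word [f] formed by its own groups. *)
move=> w; apply: contra_notP => /negP; rewrite -ltNge => bad.
have Zq j : (prefix_value b (X^~ w) (k * j) %% b ^ k < q)%N by rewrite ltn_pmod.
pose f : {ffun 'I_m -> 'I_q} := [ffun t : 'I_m => Ordinal (Zq (j0 + t)%N)].
have Qf : Q f.
  apply: ltW; apply: (lt_le_trans bad).
  by under [X in _ <= `|X|]eq_bigr do rewrite ffunE.
rewrite (bigD1 f)//=; left.
move=> p hp; have {hp} : p \in iota n (k * m) by rewrite -(seq_fsetE tt); exact: hp.
rewrite mem_iota => /andP[np pm] /=; rewrite /n in np pm.
set j := (p.-1 %/ k).+1.
have [hd hm] : p.-1 = (k * j.-1 + p.-1 %% k)%N /\ (p.-1 %% k < k)%N.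
  by rewrite ltn_pmod//= {1}(divn_eq p.-1 k) mulnC.
have jj0 : (j0 <= j)%N by nia.
have jm : (j - j0 < m)%N by nia.
have sk : (k * j - p < k)%N by nia.
have := @digit_of_group b (X^~ w) k j _ b0 (fun i => Xb i w) sk (ltn0Sn _).
have -> : (k * j - (k * j - p))%N = p by nia.
move=> ->; rewrite /a /fn.
by rewrite -/j insubT/= ffunE /= subnKC.
Qed.

(** [h i] counts the bad windows that start in the [i]-th dyadic range. Markov's inequality bounds
    the probability of a large count, and the bounds are written as differences so that their series
    telescopes for the Borel-Cantelli lemma. *)
Lemma dyadic_bad_sets_ae (R : realType) d (T : measurableType d)
    (P : probability T R) (B : nat -> set T) (e : R) :
  (forall j, measurable (B j)) ->
  (forall i j, (2 ^ i <= j < 2 ^ i.+1)%N ->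
    (P (B j) <= (2 * (i.+1%:R^-1 - i.+2%:R^-1))%:E)%E) -> 0 < e ->
  {ae P, forall w, \forall i \near \oo,
    \sum_(2 ^ i <= j < 2 ^ i.+1) (w \in B j)%:R <= e * (2 ^ i)%:R}.
Proof.
move=> mB PB e0.
pose h i w : R := \sum_(2 ^ i <= j < 2 ^ i.+1) \1_(B j) w.
pose F i := [set w | (e * (2 ^ i)%:R)%:E <= `|(h i w)%:E|]%E.
have h0 i w : 0 <= h i w by apply: sumr_ge0.
have mh i : measurable_fun setT (h i).
  by apply: measurable_sum => j; exact/measurable_indicP.
have e2 i : 0 < e * (2 ^ i)%:R by rewrite mulr_gt0// ltr0n expn_gt0.
have mF i : measurable (F i).
  rewrite /F -[X in measurable X]setTI.
  apply: measurable_lee => //.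
  by apply: measurableT_comp => //; exact/measurable_EFinP.
have PF i : (P (F i) <= (2 / e * (i.+1%:R^-1 - i.+2%:R^-1))%:E)%E.
  have M : ((e * (2 ^ i)%:R)%:E * P (F i) <= \int[P]_x `|(EFin \o h i) x|)%E.
    rewrite -[F i]setTI; apply: le_integral_abse => //.
    exact/measurable_EFinP.
  have I : (\int[P]_x `|(EFin \o h i) x| <=
      (2 ^ i)%:R%:E * (2 * (i.+1%:R^-1 - i.+2%:R^-1))%:E)%E.
    under eq_integral do rewrite /= ger0_norm//.
    rewrite /h.
    under eq_integral do rewrite -sumEFin.
    rewrite ge0_integral_sum//; last first.
      by move=> j; exact/measurable_EFinP/measurable_indicP.
    rewrite big_nat (@le_trans _ _ (\sum_(2 ^ i <= j < 2 ^ i.+1 | (2 ^ i <= j < 2 ^ i.+1)%N)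
        (2 * (i.+1%:R^-1 - i.+2%:R^-1))%:E)%E)//.
      apply: lee_sum => j hj; rewrite integral_indic// setIT; exact: PB.
    rewrite -big_nat sumEFin -EFinM lee_fin big_const_nat iter_addr_0.
    by rewrite expnS mul2n -addnn addnK -[leLHS]mulr_natl.
  have := le_trans M I.
  rewrite -[P (F i)]fineK ?fin_num_measure// -!EFinM !lee_fin => L.
  rewrite -(ler_pM2l (e2 i)); apply: (le_trans L).
  set x := (_ - _); have -> : e * (2 ^ i)%:R * (2 / e * x) = (2 ^ i)%:R * (2 * x).
    by field; rewrite gt_eqF.
  by [].
have S : (\sum_(0 <= i <oo) P (F i) < +oo)%E.
  apply: (@le_lt_trans _ _ (2 / e)%:E); last exact: ltry.
  apply: lime_le; first exact: is_cvg_nneseries.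
  apply: nearW => n.
  apply: (@le_trans _ _ (\sum_(0 <= i < n) (2 / e * (i.+1%:R^-1 - i.+2%:R^-1))%:E)%E).
    by apply: lee_sum => i _; exact: PF.
  rewrite sumEFin lee_fin -mulr_sumr ler_piMr ?divr_ge0 ?ltW//.
  under eq_bigr do rewrite -opprB.
  rewrite sumrN (telescope_sumr (fun i => i.+1%:R^-1))// opprB invr1.
  by rewrite ltrBlDr ltrDl invr_gt0.
exists (lim_sup_set F); split.
- by apply: bigcapT_measurable => n; apply: bigcup_measurable => i _.
- exact: lim_sup_set_cvg0.
move=> w /= Hw n _; apply: contrapT => Hn; apply: Hw.
exists n => // i /= ni; rewrite leNgt; apply/negP => lt; apply: Hn; exists i => //.
by rewrite /F /= lee_fin ger0_norm// ltW.
Qed.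

(** * Elementary growth estimates *)

Lemma linear_le_exp2 (R : realType) (A e : R) : 0 < e ->
  \forall i \near \oo, A * i.+1%:R <= e * (2 ^ i)%:R.
Proof.
move=> e0; exists (Num.truncn (4 * A / e)).+1 => // i /= hi.
have h1 : 4 * A / e <= i.+1%:R.
  by apply/ltW/(lt_le_trans (truncnS_gt _)); rewrite ler_nat ltnW.
(* Squaring [i / 2 + 1 <= 2 ^ (i / 2)], with integer division, gives a quadratic lower bound for
   [2 ^ i]; one factor [i + 1] absorbs the constant [4 A / e]. *)
have h2 : i.+1%:R * i.+1%:R <= 4 * (2 ^ i)%:R :> R.
  rewrite -!natrM ler_nat.
  have : (i./2.+1 ^ 2 <= 2 ^ i)%N.
    apply: (@leq_trans ((2 ^ i./2) ^ 2)%N); first by rewrite leq_exp2r// ltn_expl.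
    by rewrite -expnM leq_exp2l//; lia.
  by have := odd_double_half i; nia.
have h3 : 0 < i.+1%:R :> R by rewrite ltr0n.
move: h1; rewrite ler_pdivrMr// => h1.
nra.
Qed.

(** The quadratic bound for the exponential at [1 / 2] is exactly 2. *)
Lemma ln2_ge_half (R : realType) : 2^-1 <= ln 2 :> R.
Proof.
rewrite -ler_expR lnK ?posrE//; apply: (le_trans (expR_le_quadratic _)) => //.
lra.
Qed.

Lemma ln_pow2_ge (R : realType) i n : (2 ^ i <= n)%N -> i%:R / 2 <= ln n%:R :> R.
Proof.
move=> hn; apply: (@le_trans _ _ (ln (2 ^+ i))).
  by rewrite lnXn// -[leRHS]mulr_natl ler_wpM2l// ln2_ge_half.
by rewrite ler_ln ?posrE ?exprn_gt0// -?natrX ?ler_nat// ltr0n (leq_trans _ hn)// expn_gt0.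
Qed.

(** From [i = 6] on, [(i / 2)^2 >= i + 2]. *)
Lemma lnln_pow2_ge (R : realType) i n : (6 <= i)%N -> (2 ^ i <= n)%N ->
  ln i.+2%:R / 2 <= ln (ln n%:R) :> R.
Proof.
move=> i6 hn; have i6' : 6 <= i%:R :> R by rewrite ler_nat.
have h := ln_pow2_ge R hn.
apply: (@le_trans _ _ (ln (i%:R / 2))); last by rewrite ler_ln ?posrE//; lra.
rewrite ler_pdivrMr// mulr_natr -lnXn; last lra.
rewrite ler_ln ?posrE ?ltr0n//; last by rewrite exprn_gt0//; lra.
rewrite -addn2 natrD; nra.
Qed.

Lemma ln_ge1 (R : realType) i : (2 <= i)%N -> 1 <= ln i.+2%:R :> R.
Proof.
move=> i2; have := @ln_pow2_ge R 2 i.+2 (i2 : (2 ^ 2 <= i.+2)%N).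
by rewrite divff.
Qed.

(** * Almost sure frequencies of groups of digits *)

Lemma dyadic_sums_small (R : realType) b d (T : measurableType d)
    (P : probability T R) (X : nat -> {RV P >-> nat}) (g : nat -> R) k
    (c : 'I_(b ^ k)) (e : R) :
  (0 < b)%N -> (forall n w, (1 <= n)%N -> (X n w < b)%N) ->
  (forall n, (1 <= n)%N -> uniform_digit b (X n)) ->
  g n @[n --> \oo] --> +oo ->
  (\forall n \near \oo, mutually_independent (window n (g n * ln (ln n%:R))) X) ->
  (0 < k)%N -> 0 < e <= 2 ->
  {ae P, forall w, \forall i \near \oo, forall N, (2 ^ i <= N <= 2 ^ i.+1)%N ->
    `|\sum_(2 ^ i <= j < N) ((prefix_value b (X^~ w) (k * j) %% b ^ k == c)%N%:R
         - (b ^ k)%:R^-1)| <= 4 * e * (2 ^ i)%:R}.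
Proof.
move=> b0 Xb uX goo indX k0 /andP[e0 e2].
pose L i : R := ln i.+2%:R.
(* With a window of [m i >= C * L i] groups, Chernoff's exponent is at least [2 * L i], so the bound
   is at most [2 / (i + 2)^2], below the telescoping term [2 / ((i + 1) (i + 2))]. *)
pose C : R := 16 / e ^+ 2.
have C0 : 0 < C by rewrite divr_gt0// exprn_gt0.
pose m i := (Num.truncn (C * L i)).+1.
have L0 i : 0 <= L i by apply: ln_ge0; rewrite ler1n.
have m_ge i : C * L i <= (m i)%:R by apply/ltW/truncnS_gt.
have m_le i : (m i)%:R <= C * L i + 1.
  by rewrite -natr1 lerD2r truncn_le mulr_ge0// ltW.
have [N1 _ H1] := indX.
(* A window needs [k * m i <= k * (C + 1) * L i] digits, while [ln (ln n)] is only known to be at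
   least [L i / 2]; hence the factor 2. *)
have [N2 _ H2] := (iffLR (cvgryPge _) goo) (2 * k%:R * (C + 1)).
have [N3 _ H3] := linear_le_exp2 (2 * C + 1) e0.
pose I0 := maxn (maxn N1 N2) (maxn N3 6).
have m_small i : (I0 <= i)%N -> (m i)%:R <= e * (2 ^ i)%:R.
  move=> hi; apply: le_trans (m_le i) _; apply: le_trans (H3 i _); last by rewrite /=; lia.
  have : L i <= i.+1%:R.
    by rewrite /L -natr1 addrC le_ln1Dx// (@lt_le_trans _ _ 0)// ?ltrN10 ?ler0n.
  have : 1 <= i.+1%:R :> R by rewrite ler1n.
  move: C0; nra.
have cov j : exists B, [/\ measurable B,
    forall i, (2 ^ i <= j < 2 ^ i.+1)%N ->
      (P B <= (2 * (i.+1%:R^-1 - i.+2%:R^-1))%:E)%E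
  & forall i, (2 ^ i <= j < 2 ^ i.+1)%N -> (I0 <= i)%N -> forall w, ~ B w ->
      `|\sum_(t < m i) ((prefix_value b (X^~ w) (k * (j + t)) %% b ^ k == c)%N%:R
         - (b ^ k)%:R^-1)| <= e * (m i)%:R].
  case: (boolP ((0 < j)%N && (I0 <= trunc_log 2 j)%N)) => [/andP[j0 jI]|]; last first.
    move=> hj; exists set0; split => //.
      move=> i _; rewrite measure0 lee_fin mulr_ge0// subr_ge0.
      by rewrite lef_pV2 ?posrE ?ltr0n// ler_nat.
    move=> i hi iI; exfalso; move: hj; rewrite (trunc_log_eq _ hi)// iI andbT.
    by have := expn_gt0 2 i; lia.
  have /andP[j1 j2] := trunc_log_bounds (isT : 1 < 2)%N j0.
  move: jI j1 j2; set i := trunc_log 2 j => jI j1 j2.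
  have iE i' : (2 ^ i' <= j < 2 ^ i'.+1)%N -> i' = i.
    by move=> hi; rewrite /i (trunc_log_eq _ hi).
  (* The first digit position of group [j]. As [n >= j >= 2 ^ i], the estimates for the range of [j]
     also hold at [n]. *)
  set n := (k * j.-1).+1.
  have jn : (j <= n)%N by rewrite /n; nia.
  have n2i : (2 ^ i <= n)%N by exact: leq_trans jn.
  have in2 : (i < 2 ^ i)%N by exact: ltn_expl.
  have ind := H1 n ltac:(rewrite /=; lia).
  have gn := H2 n ltac:(rewrite /=; lia).
  have [] := @bad_window_cover R b d T P X _ k (m i) j c e b0 Xb uX k0 j0 ind.
  - move=> p /andP[p1 p2]; split => //.
    have km : ((k * m i)%N%:Z <= Num.ceil (g n * ln (ln n%:R)))%R.
      rewrite -(ler_int R); apply: le_trans (ceil_ge _).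
      have hl := @lnln_pow2_ge R i n ltac:(lia) n2i.
      have hL := @ln_ge1 R i ltac:(lia).
      rewrite -/(L i) in hl hL.
      apply: (@le_trans _ _ (k%:R * (C + 1) * L i)).
        rewrite -[leLHS]/((k * m i)%:R : R) natrM -mulrA ler_wpM2l//.
        by apply: le_trans (m_le i) _; rewrite mulrDl mul1r lerD2l.
      apply: (@le_trans _ _ (2 * k%:R * (C + 1) * (L i / 2))).
        by rewrite le_eqVlt; apply/orP; left; apply/eqP; field.
      by apply: ler_pM => //; rewrite ?mulr_ge0// ?divr_ge0// addr_ge0// ltW.
    apply: (@le_trans _ _ (n%:Z + (k * m i)%N%:Z)); last by rewrite lerD2l.
    rewrite /n; lia.
  - by rewrite e2 ltW.
  move=> B [mB PB HB]; exists B; split => // i' /iE -> //.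
  apply: le_trans PB _; rewrite lee_fin ler_pM2l//.
  have : expR (- (e ^+ 2 / 8) * (m i)%:R) <= expR (- (L i + L i)).
    rewrite ler_expR mulNr lerN2.
    apply: (@le_trans _ _ (e ^+ 2 / 8 * (C * L i))).
      rewrite le_eqVlt; apply/orP; left; apply/eqP; rewrite /C; field.
      by rewrite gt_eqF.
    by rewrite ler_wpM2l// divr_ge0// exprn_ge0// ltW.
  move=> h; apply: (le_trans h).
  rewrite expRN expRD /L lnK ?posrE// invfM.
  have : i.+2%:R = i.+1%:R + 1 :> R by rewrite natr1.
  have : 0 < i.+1%:R :> R by rewrite ltr0n.
  move: (i.+1%:R) => x x0 ->.
  have -> : x^-1 - (x + 1)^-1 = x^-1 * (x + 1)^-1.
    by field; rewrite !gt_eqF// addr_gt0.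
  by rewrite ler_pM2r ?invr_gt0 ?addr_gt0// lef_pV2 ?posrE ?addr_gt0// lerDl.
have [B HB] := choice cov.
have mB j : measurable (B j) by have [] := HB j.
have PB i j : (2 ^ i <= j < 2 ^ i.+1)%N ->
    (P (B j) <= (2 * (i.+1%:R^-1 - i.+2%:R^-1))%:E)%E.
  by move=> hj; have [_ h _] := HB j; exact: h.
have := dyadic_bad_sets_ae mB PB e0; apply: filterS => w [N4 _ H4].
exists (maxn I0 N4) => // i /= hi N /andP[N1' N2'].
have q1 : 0 <= ((b ^ k)%:R^-1 : R) <= 1.
  by rewrite invr_ge0 ler0n invf_le1 ?ler1n ?ltr0n expn_gt0 b0.
(* The three terms are at most [2 e], [e] and [e] times [2 ^ i], which gives the constant 4. *)
apply: (le_trans (@sum_le_bad_windows R _ (m i) (2 ^ i) N e (fun j => w \in B j) _ _ _ _ _)) => //.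
- by move=> j; rewrite ler_norml; case: eqP => _ /=; lra.
- exact: ltW.
- move=> j /andP[j1 j2] /negP; rewrite inE => nB.
  have [_ _ h] := HB j; apply: h => //; last lia.
  by rewrite j1 (leq_trans j2).
have h1 := m_small i ltac:(lia).
have h2 : (N - 2 ^ i)%:R <= (2 ^ i)%:R :> R.
  by rewrite ler_nat; move: N2'; rewrite expnS; lia.
have h3 : \sum_(2 ^ i <= j < N) (w \in B j)%:R <= e * (2 ^ i)%:R.
  apply: le_trans (H4 i _); last by rewrite /=; lia.
  by rewrite (@big_cat_nat _ _ _ N (2 ^ i)%N (2 ^ i.+1)%N)//= lerDl sumr_ge0.
have := ler_wpM2l (ltW e0) h2; lra.
Qed.

Lemma sum_indicator_count (R : realType) (p : pred nat) (s : seq nat) :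
  \sum_(j <- s) (p j)%:R = (count p s)%:R :> R.
Proof. by elim: s => [|j s IH]; rewrite ?big_nil// big_cons IH natrD. Qed.

Lemma ae_group_frequency (R : realType) b d (T : measurableType d)
    (P : probability T R) (X : nat -> {RV P >-> nat}) (g : nat -> R) k c :
  (0 < b)%N -> (forall n w, (1 <= n)%N -> (X n w < b)%N) ->
  (forall n, (1 <= n)%N -> uniform_digit b (X n)) ->
  g n @[n --> \oo] --> +oo ->
  (\forall n \near \oo, mutually_independent (window n (g n * ln (ln n%:R))) X) ->
  (0 < k)%N -> (c < b ^ k)%N ->
  {ae P, forall w,
    (count (fun j => prefix_value b (X^~ w) (k * j) %% b ^ k == c)%N (iota 1 n))%:R
      / n%:R @[n --> \oo] --> ((b ^ k)%:R^-1 : R)}.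
Proof.
move=> b0 Xb uX goo indX k0 cq.
have e_bd r : 0 < (r.+1%:R^-1 : R) <= 2.
  rewrite invr_gt0 ltr0n /= (@le_trans _ _ 1)// ?ler1n//.
  by rewrite invf_le1 ?ltr0n// ler1n.
(* Only the countably many errors [1 / (r + 1)] are used, so that the exceptional sets have a null
   union. *)
have := ae_foralln
  (fun r => dyadic_sums_small (Ordinal cq) b0 Xb uX goo indX k0 (e_bd r)).
apply: filterS => w H; set q := (b ^ k)%N in H *.
set p := (fun j => (prefix_value b (X^~ w) (k * j) %% q == c)%N).
have q1 : 0 <= (q%:R^-1 : R) <= 1.
  by rewrite invr_ge0 ler0n invf_le1 ?ler1n ?ltr0n expn_gt0 b0.
have : (\sum_(1 <= j < n.+1) ((p j)%:R - q%:R^-1)) / n%:R @[n --> \oo] --> (0 : R).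
  apply: cesaro_dyadic => [j|e e0].
    by rewrite ler_norml; case: (p j) => /=; lra.
  have [I _ HI] := H (Num.truncn (4 / e)).
  exists I => // i /= Ii N hN; apply: le_trans (HI i Ii N hN) _.
  rewrite ler_wpM2r// ler_pdivrMr ?ltr0n// mulrC -ler_pdivrMr//.
  exact/ltW/truncnS_gt.
move=> /(cvgD (cvg_cst (q%:R^-1 : R))); rewrite addr0.
apply: cvg_trans; apply: near_eq_cvg; exists 1%N => // n /= n0.
rewrite -[LHS]/(q%:R^-1 + (\sum_(1 <= j < n.+1) ((p j)%:R - q%:R^-1)) / n%:R).
rewrite /index_iota subSS subn0 sumrB sum_indicator_count big_const_seq count_predT.
rewrite size_iota iter_addr_0 -[q%:R^-1 *+ n]mulr_natr.
by field; rewrite pnatr_eq0 -lt0n n0 pnatr_eq0 -lt0n expn_gt0 b0.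
Qed.

Lemma ae_normal_number (R : realType) b d (T : measurableType d)
    (P : probability T R) (X : nat -> {RV P >-> nat}) (g : nat -> R) :
  (1 < b)%N -> (forall n w, (1 <= n)%N -> (X n w < b)%N) ->
  (forall n, (1 <= n)%N -> uniform_digit b (X n)) ->
  g n @[n --> \oo] --> +oo ->
  (\forall n \near \oo, mutually_independent (window n (g n * ln (ln n%:R))) X) ->
  {ae P, forall w, normal_number b (number_of_digits R b (X^~ w))}.
Proof.
move=> b1 Xb uX goo indX; have b0 := ltnW b1.
have : {ae P, forall w, forall k c, (0 < k)%N -> (c < b ^ k)%N ->
    (count (fun j => prefix_value b (X^~ w) (k * j) %% b ^ k == c)%N (iota 1 n))%:R
      / n%:R @[n --> \oo] --> ((b ^ k)%:R^-1 : R)}.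
  apply: ae_foralln => k; apply: ae_foralln => c.
  have [k0|k0] := ltnP 0 k; last by apply: aeW => w; lia.
  have [cq|cq] := ltnP c (b ^ k); last by apply: aeW => w; lia.
  by have := ae_group_frequency b0 Xb uX goo indX k0 cq; apply: filterS.
apply: filterS => w H; have xb j := Xb j w.
(* The case [k = 1], [c = 0] gives the digit 0 a positive frequency, so the sequence does not end in
   [b - 1] forever. Hence its groups of [k] digits are the base [b ^ k] digits of the number. *)
have io : forall N, exists2 j, (N <= j)%N & (X j.+1 w).+1 != b.
  move=> N; apply: contrapT => HN.
  have := H 1%N 0%N isT; rewrite expn1 => /(_ b0) h.
  have c0 : (count (fun j => prefix_value b (X^~ w) (1 * j) %% b == 0)%N (iota 1 n))%:R
      / n%:R @[n --> \oo] --> (0 : R).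
    apply: (@count_finite_freq0 _ _ N) => -[//|j] Nj.
    rewrite mul1n prefix_value_mod ?xb//; apply/eqP => x0; apply: HN; exists j => //.
    by rewrite x0; lia.
  have : b%:R^-1 = 0 :> R by exact: cvg_unique (@Rhausdorff R) _ _ _ _ h c0.
  by move/eqP; rewrite invr_eq0 pnatr_eq0 -leqn0 leqNgt b0.
move=> k k0 c cq; under eq_fun => n.
  under eq_count do rewrite (digit_number_of_digits R k _ b0 xb io).
  over.
exact: H.
Qed.

(** * The digits of a uniform point *)

Lemma truncn_mul_div (R : realType) (y : R) b : (0 < b)%N -> 0 <= y ->
  (Num.truncn (y * b%:R) %/ b)%N = Num.truncn y.
Proof.
move=> b0 y0; have b0' : 0 < b%:R :> R by rewrite ltr0n.
have /truncn_itv/andP[v1 v2] : 0 <= y * b%:R by rewrite mulr_ge0// ltW.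
apply/esym/truncn_def; set v := Num.truncn _ in v1 v2 *.
rewrite -(ler_pM2r b0') -(ltr_pM2r b0') -!natrM; apply/andP; split.
  by apply: le_trans v1; rewrite ler_nat leq_trunc_div.
apply: (lt_le_trans v2); rewrite ler_nat; exact: ltn_ceil.
Qed.

(** By induction: dividing the truncation at level [n + 1] by [b] leaves the truncation at level [n]
    as quotient and the new digit as remainder. *)
Lemma digits_prefix_value (R : realType) (w : R) b x n : (0 < b)%N ->
  0 <= w < 1 -> (forall j, (0 < j)%N -> (x j < b)%N) ->
  (forall j, (0 < j <= n)%N -> digit b w j = x j) <->
  Num.truncn (w * b%:R ^+ n) = prefix_value b x n.
Proof.
move=> b0 /andP[w0 w1] xb; elim: n => [|n IH].
  split=> [_|_ j]; last lia.
  by rewrite mulr1; apply: truncn_def; rewrite w0 w1.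
have D : (Num.truncn (w * b%:R ^+ n.+1) %/ b)%N = Num.truncn (w * b%:R ^+ n).
  by rewrite exprSr mulrA truncn_mul_div// mulr_ge0// exprn_ge0.
have E : digit b w n.+1 = (Num.truncn (w * b%:R ^+ n.+1) %% b)%N.
  by rewrite /digit ger0_norm.
split=> [H|H].
  rewrite (divn_eq (Num.truncn _) b) D -E H ?ltnSn// (iffLR IH)/= 1?mulnC//.
  by move=> j /andP[j0 jn]; apply: H; rewrite j0 leqW.
have {}IH : forall j, (0 < j <= n)%N -> digit b w j = x j.
  apply/IH; rewrite -D H /= mulnC divnMDl// divn_small ?xb// addn0//.
move=> j /andP[j0]; rewrite leq_eqVlt => /orP[/eqP ->|jn]; last by apply: IH; rewrite j0.
by rewrite E H prefix_value_mod// xb.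
Qed.

Lemma uniform_prob01E (R : realType) (E : set R) : measurable E ->
  uniform_prob (@ltr01 R) E = lebesgue_measure (E `&` `[0, 1]).
Proof.
move=> mE; rewrite /uniform_prob integral_uniform_pdf.
rewrite (eq_integral (fun=> 1%:E)); last first.
  by move=> x; rewrite inE => -[_]; rewrite /uniform_pdf /= in_itv/= => ->; rewrite subr0 invr1.
by rewrite integral_cst ?mul1e//; exact: measurableI.
Qed.

Definition unif01 (R : realType) : probability (measurableTypeR R) R :=
  uniform_prob (@ltr01 R).

(** Takes the point last, so that it can be declared a random variable on [unif01]. *)
Definition digit_fun (R : realType) (b j : nat) : measurableTypeR R -> nat :=
  fun w => digit b w j.

Lemma measurable_digit_fun (R : realType) b j :
  measurable_fun setT (@digit_fun R b j).
Proof.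
move=> _ Y _; rewrite setTI.
have -> : digit_fun b j @^-1` Y = \bigcup_(k in [set k : nat | Y (k %% b)%N])
    ((fun w : R => `|w| * b%:R ^+ j) @^-1` `[k%:R, k.+1%:R[).
  apply/seteqP; split => w /=; rewrite /digit_fun /digit.
    move=> Yw; exists (Num.truncn (`|w| * b%:R ^+ j)) => //=.
    by rewrite in_itv /= truncn_itv// mulr_ge0// exprn_ge0.
  by move=> [k /= Yk]; rewrite in_itv/= => /truncn_def ->.
apply: bigcup_measurable => k _; rewrite -[X in measurable X]setTI.
by apply: measurable_funM => //; exact: measurable_normr.
Qed.

HB.instance Definition _ (R : realType) b j :=
  isMeasurableFun.Build _ _ _ _ (@digit_fun R b j) (@measurable_digit_fun R b j).

Lemma digits_prob (R : realType) b x n : (0 < b)%N ->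
  (forall j, (0 < j)%N -> (x j < b)%N) ->
  unif01 R [set w : R | forall j, (0 < j <= n)%N -> digit b w j = x j] =
  ((b%:R ^+ n)^-1)%:E.
Proof.
move=> b0 xb; have b0' : 0 < b%:R :> R by rewrite ltr0n.
set E := [set w | _].
have mE : measurable E.
  have -> : E = \bigcap_(j in [set j | (0 < j <= n)%N]) (digit_fun b j @^-1` [set x j]).
    by apply/seteqP; split.
  apply: bigcap_measurableType => j _; rewrite -[X in measurable X]setTI.
  exact: measurable_digit_fun.
rewrite /unif01 /= uniform_prob01E//; set c := prefix_value b x n.
have bn0 : 0 < b%:R ^+ n :> R by rewrite exprn_gt0.
have cb : c.+1%:R <= b%:R ^+ n :> R.
  by rewrite -natrX ler_nat; exact: prefix_value_lt.
set I := `[c%:R / b%:R ^+ n, c.+1%:R / b%:R ^+ n[%classic : set R.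
have EI w : 0 <= w < 1 -> E w <-> I w.
  move=> w01; rewrite /E /= (digits_prefix_value _ b0 w01 xb) -/c /I /= in_itv /=.
  rewrite ler_pdivrMr// ltr_pdivlMr//; split=> [<-|/truncn_def//].
  by apply: truncn_itv; case/andP: w01 => w0 _; rewrite mulr_ge0// ltW.
have I01 w : I w -> 0 <= w < 1.
  rewrite /I /= in_itv/= => /andP[w1 w2]; apply/andP; split.
    by apply: le_trans w1; rewrite divr_ge0// ltW.
  by apply: (lt_le_trans w2); rewrite ler_pdivrMr// mul1r.
have mI : measurable I by exact: measurable_itv.
have lI : lebesgue_measure I = ((b%:R ^+ n)^-1)%:E.
  rewrite lebesgue_measure_itv/= lte_fin ltr_pM2r ?invr_gt0// ltr_nat ltnSn.
  by rewrite -EFinD -mulrBl -natr1 addrC addKr mul1r.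
have mEI : measurable (E `&` `[0, 1]) by exact: measurableI.
apply/eqP; rewrite eq_le; apply/andP; split.
  (* Inside [[0, 1[] the event is the interval [I]; the remaining point 1 of [[0, 1]] is added as a
     null set. *)
  apply: (@le_trans _ _ (lebesgue_measure (I `|` [set 1]))).
    apply: le_measure; rewrite ?inE//; first exact: measurableU.
    move=> w [Ew]; rewrite /= in_itv/= => /andP[w0]; rewrite le_eqVlt => /orP[/eqP ->|w1].
      by right.
    by left; apply/EI => //; rewrite w0.
  have -> : ((b%:R ^+ n)^-1)%:E = (lebesgue_measure I + lebesgue_measure [set 1%R : R])%E.
    by rewrite lebesgue_measure_set1 adde0 lI.
  exact: measureU2.
rewrite -lI; apply: le_measure; rewrite ?inE// => w Iw.
have w01 := I01 w Iw; split; first exact/EI.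
by rewrite /= in_itv/=; case/andP: w01 => -> /ltW ->.
Qed.

Lemma digit_lt (R : realType) b (w : R) j : (0 < b)%N -> (digit b w j < b)%N.
Proof. by move=> b0; rewrite /digit ltn_pmod. Qed.

(* Entry [i] is the digit of index [o + i + 1], digits being numbered from 1. *)
Definition digit_word (R : realType) b (b0 : (0 < b)%N) o n (w : R) :
    {ffun 'I_n -> 'I_b} :=
  [ffun i : 'I_n => Ordinal (digit_lt w (o + i).+1 b0)].

Lemma digit_word_prob (R : realType) b (b0 : (0 < b)%N) n
    (A : pred {ffun 'I_n -> 'I_b}) :
  measurable [set w : R | A (digit_word b0 0 n w)] /\
  unif01 R [set w : R | A (digit_word b0 0 n w)] =
  (#|A|%:R / b%:R ^+ n)%:E.
Proof.
have b0' : 0 < b%:R ^+ n :> R by rewrite exprn_gt0// ltr0n.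
pose x (f : {ffun 'I_n -> 'I_b}) j : nat :=
  oapp (fun i : 'I_n => f i : nat) 0%N (insub j.-1).
have xb f j : (0 < j)%N -> (x f j < b)%N.
  by move=> _; rewrite /x; case: insubP => [i _ _|_] //=.
pose W f := [set w : R | forall j, (0 < j <= n)%N -> digit b w j = x f j].
have WE f w : W f w <-> digit_word b0 0 n w = f.
  split=> [H|<-].
    apply/ffunP => i; rewrite ffunE; apply: val_inj => /=.
    rewrite add0n H /= ?ltn_ord// /x /=.
    by have -> : insub (i : nat) = Some i by exact: valK.
  by move=> [//|j] /andP[_ jn]; rewrite /x /= insubT /= ffunE.
have mW f : measurable (W f).
  have -> : W f = \bigcap_(j in [set j | (0 < j <= n)%N]) (digit_fun b j @^-1` [set x f j]).
    by apply/seteqP; split.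
  apply: bigcap_measurableType => j _; rewrite -[X in measurable X]setTI.
  exact: measurable_digit_fun.
have AE (B : pred {ffun 'I_n -> 'I_b}) :
    [set w : R | B (digit_word b0 0 n w)] = \big[setU/set0]_(f | B f) W f.
  apply/seteqP; split=> [w /= Bw|w].
    by rewrite (bigD1 _ Bw)/=; left; exact/WE.
  elim/big_ind: _ => // [U V hU hV [/hU|/hV]//|f Bf /WE]; by move=> /= ->.
have mA (B : pred {ffun 'I_n -> 'I_b}) :
    measurable [set w : R | B (digit_word b0 0 n w)] /\
    (unif01 R [set w : R | B (digit_word b0 0 n w)] <=
      (#|B|%:R / b%:R ^+ n)%:E)%E.
  rewrite AE; have [mU leU] := @measure_bigsetU_le _ _ R (unif01 R) _ B W mW.
  split=> //; apply: (le_trans leU).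
  rewrite (eq_bigr (fun=> ((b%:R ^+ n)^-1)%:E)); last first.
    by move=> f _; exact: (@digits_prob R b (x f) n b0 (xb f)).
  by rewrite sumEFin lee_fin sumr_const -[leLHS]mulr_natl.
split; first by have [] := mA A.
(* The upper bounds for [A] and for its complement add up to 1. *)
have [mS leS] := mA A; have [mC leC] := mA (predC A).
have eC : [set w : R | predC A (digit_word b0 0 n w)] = ~` [set w : R | A (digit_word b0 0 n w)].
  by apply/seteqP; split=> w /= /negP.
rewrite eC probability_setC// in leC.
apply/eqP; rewrite eq_le leS /=.
rewrite -[X in (_ <= X)%E]fineK ?fin_num_measure// lee_fin.
move: leC; rewrite -[X in (1 - X)%E]fineK ?fin_num_measure// -EFinB lee_fin.
have : #|predC A|%:R = b%:R ^+ n - #|A|%:R :> R.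
  apply/eqP; rewrite eq_sym subr_eq addrC -natrD cardC card_ffun !card_ord.
  by rewrite natrX.
move=> ->; rewrite mulrBl divff ?gt_eqF//; lra.
Qed.

(** By injectivity each position is constrained by at most one [j] of [J], so the event is a product
    set of words and its cardinal factorises. An unconstrained position contributes the factor
    [b / b]. *)
Lemma digit_cylinder_prob (R : realType) b (phi : nat -> nat) (I : set nat)
    (J : {fset nat}) (A : nat -> set nat) :
  (0 < b)%N -> (forall m n, I m -> I n -> phi m = phi n -> m = n) ->
  [set` J] `<=` I ->
  unif01 R (\bigcap_(j in [set` J]) (digit_fun b (phi j).+1 @^-1` A j)) =
  (\prod_(j <- J) (#|[pred u : 'I_b | (u : nat) \in A j]|%:R / b%:R))%:E.
Proof.
move=> b0 inj JI; pose n := (\max_(j <- J) phi j).+1.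
have phin j : j \in J -> (phi j < n)%N by move=> jJ; rewrite ltnS; exact: leq_bigmax_seq.
pose F (i : 'I_n) := [pred u : 'I_b | all (fun j => (phi j == i) ==> ((u : nat) \in A j)) J].
have -> : \bigcap_(j in [set` J]) (digit_fun b (phi j).+1 @^-1` A j) =
    [set w : R | (fun f : {ffun 'I_n -> 'I_b} => f \in family F) (digit_word b0 0 n w)].
  apply/seteqP; split=> w /=.
    move=> H; apply/familyP => i; rewrite ffunE inE; apply/allP => j jJ.
    by apply/implyP => /eqP /= <-; rewrite inE; exact: H.
  move=> /familyP H j /= jJ; have := H (Ordinal (phin j jJ)).
  by rewrite ffunE inE => /allP /(_ j jJ) /=; rewrite eqxx /= inE.
have [_ ->] := digit_word_prob R b0 (fun f : {ffun 'I_n -> 'I_b} => f \in family F).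
congr EFin.
have -> : #|(fun f : {ffun 'I_n -> 'I_b} => f \in family F)| = (\prod_(i < n) #|F i|)%N.
  rewrite -[LHS]/#|family F| card_family foldrE big_map big_enum.
  by [].
rewrite natr_prod -[n in b%:R ^+ n]card_ord -prodr_const -prodf_div.
(* Each factor is attached to the position [phi j], so that the products over indices and positions
   can be exchanged. *)
transitivity (\prod_(j <- J) \prod_(i < n | phi j == i)
  (#|[pred u : 'I_b | (u : nat) \in A j]|%:R / b%:R : R)); last first.
  apply: eq_big_seq => j jJ; rewrite (big_pred1 (Ordinal (phin j jJ)))//.
rewrite (exchange_big_dep xpredT)//=; apply: eq_bigr => i _.
case: (boolP (has (fun j => phi j == i) J)) => [/hasP[j jJ /eqP ji]|/hasPn ni].
  have uJ : uniq J by exact: fset_uniq.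
  rewrite big_mkcond (bigD1_seq j)//= ji eqxx big1_seq ?mulr1; last first.
    move=> j' /andP[/eqP jj' j'J]; case: eqP => // ij'; exfalso; apply: jj'.
    by apply: inj; [exact: JI|exact: JI|rewrite ij' ji].
  congr (_%:R / _); apply: eq_card => u; rewrite !inE; apply/allP/idP => [H|H j' j'J].
    by have := H j jJ; rewrite ji eqxx.
  apply/implyP => /eqP j'i.
  by have -> : j' = j by apply: inj; [exact: JI|exact: JI|rewrite j'i ji].
rewrite big1_seq; last by move=> j /andP[/eqP ji /ni]; rewrite ji eqxx.
rewrite (@eq_card _ _ predT) ?card_ord ?divff ?pnatr_eq0 -?lt0n//.
by move=> u; rewrite !inE; apply/allP => j /ni /negbTE ->.
Qed.

Lemma digit_preimage_prob (R : realType) b j (A : set nat) : (0 < b)%N ->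
  unif01 R (digit_fun b j.+1 @^-1` A) =
  (#|[pred u : 'I_b | (u : nat) \in A]|%:R / b%:R)%:E.
Proof.
move=> b0.
have <- : \bigcap_(i in [set` [fset j]%fset]) (digit_fun b i.+1 @^-1` A) =
    digit_fun b j.+1 @^-1` A :> set R.
  apply/seteqP; split=> w wj.
    by apply: (wj j); rewrite /= inE.
  by move=> j' /=; rewrite inE => /eqP ->; exact: wj.
rewrite (@digit_cylinder_prob R b id setT [fset j]%fset (fun=> A))//.
by rewrite big_seq_fset1.
Qed.

Lemma mutually_independent_digits (R : realType) b (phi : nat -> nat) (I : set nat) :
  (0 < b)%N -> (forall m n, I m -> I n -> phi m = phi n -> m = n) ->
  mutually_independent I
    (fun n => (digit_fun b (phi n).+1 : {RV (unif01 R) >-> nat})).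
Proof.
move=> b0 inj J JI A mA; rewrite (@digit_cylinder_prob R b phi I)// -prodEFin.
by apply: eq_bigr => j _; rewrite digit_preimage_prob.
Qed.

Lemma uniform_digit_fun (R : realType) b j : (0 < b)%N ->
  uniform_digit b (digit_fun b j.+1 : {RV (unif01 R) >-> nat}).
Proof.
move=> b0 a ab; rewrite /distribution /pushforward digit_preimage_prob//.
congr EFin; rewrite (fintype.eq_card1 (x := Ordinal ab)) ?div1r// => u.
rewrite !inE; apply/idP/eqP => [|->]; rewrite inE//= => ua; exact: val_inj.
Qed.

(** * Part (ii) *)

(** The counting form of the independence of two consecutive blocks; [h] is concatenation. *)
Lemma card_split_ffun (T : finType) o m (A : pred {ffun 'I_o -> T})
    (B : pred {ffun 'I_m -> T}) :
  #|[pred f : {ffun 'I_(o + m) -> T} |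
      A [ffun i => f (lshift m i)] && B [ffun i => f (rshift o i)]]| =
  (#|A| * #|B|)%N.
Proof.
pose h (p : {ffun 'I_o -> T} * {ffun 'I_m -> T}) : {ffun 'I_(o + m) -> T} :=
  [ffun i => match fintype.split i with inl i => p.1 i | inr i => p.2 i end].
pose l (f : {ffun 'I_(o + m) -> T}) := [ffun i => f (lshift m i)].
pose r (f : {ffun 'I_(o + m) -> T}) := [ffun i => f (rshift o i)].
have lh p : l (h p) = p.1.
  by apply/ffunP => i; rewrite !ffunE (unsplitK (inl i)).
have rh p : r (h p) = p.2.
  by apply/ffunP => i; rewrite !ffunE (unsplitK (inr i)).
have bh : bijective h.
  exists (fun f => (l f, r f)) => [p|f]; first by rewrite lh rh; case: p.
  apply/ffunP => i; rewrite ffunE -{2}(splitK i).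
  by case: (fintype.split i) => j /=; rewrite ffunE.
rewrite -sum1_card (reindex h) /=; last exact: onW_bij.
rewrite -!sum1_card big_distrlr /= pair_big_dep /=.
by apply: eq_bigl => p; rewrite !inE -/(l (h p)) -/(r (h p)) lh rh.
Qed.

(** * Good blocks of fresh digits *)

Fixpoint offset (m : nat -> nat) (i : nat) : nat :=
  if i is i'.+1 then (offset m i' + m i')%N else 0%N.

(** Expresses the absence of good blocks by the finite word of all digits before [offset m I], to
    which [digit_word_prob] applies. The digits before block [i0] are left free, and each further
    block multiplies the proportion of words by its chance of not being good. *)
Lemma no_good_block (R : realType) b (b0 : (0 < b)%N) (m : nat -> nat)
    (G : forall i, pred {ffun 'I_(m i) -> 'I_b}) i0 I : (i0 <= I)%N ->
  exists A : pred {ffun 'I_(offset m I) -> 'I_b},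
    (forall w : R, (forall i, (i0 <= i < I)%N ->
        ~~ G i (digit_word b0 (offset m i) (m i) w)) ->
      A (digit_word b0 0 (offset m I) w)) /\
    #|A|%:R / b%:R ^+ offset m I =
      \prod_(i0 <= i < I) (1 - #|G i|%:R / b%:R ^+ m i) :> R.
Proof.
have b0' : b%:R != 0 :> R by rewrite pnatr_eq0 -lt0n.
elim: I => [|I IH].
  rewrite leqn0 => /eqP ->; exists predT; split => //.
  rewrite big_geq// (eq_card (B := {: {ffun 'I_0 -> 'I_b}}))// card_ffun !card_ord.
  by rewrite expn0 expr0 divr1.
rewrite leq_eqVlt => /orP[/eqP <-|].
  exists predT; split => //.
  rewrite big_geq// (eq_card (B := {: {ffun 'I_(offset m i0) -> 'I_b}}))//.
  by rewrite card_ffun !card_ord natrX divff// expf_neq0.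
rewrite ltnS => iI; have [A [HA cA]] := IH iI.
exists [pred f : {ffun 'I_(offset m I + m I) -> 'I_b} |
  A [ffun i => f (lshift (m I) i)] && ~~ G I [ffun i => f (rshift (offset m I) i)]].
split=> [w H /=|].
  have -> : [ffun i => digit_word b0 0 (offset m I + m I) w (lshift (m I) i)] =
      digit_word b0 0 (offset m I) w.
    by apply/ffunP => i; rewrite !ffunE; apply: val_inj.
  have -> : [ffun i => digit_word b0 0 (offset m I + m I) w (rshift (offset m I) i)] =
      digit_word b0 (offset m I) (m I) w.
    by apply/ffunP => i; rewrite !ffunE; apply: val_inj.
  rewrite HA ?H//= ?iI ?ltnSn// => i /andP[i1 i2]; apply: H.
  by rewrite i1 ltnS ltnW.
rewrite big_nat_recr//= -cA (card_split_ffun A (predC (G I))).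
rewrite natrM exprD; have -> : #|predC (G I)|%:R = b%:R ^+ m I - #|G I|%:R :> R.
  apply/eqP; rewrite eq_sym subr_eq addrC -natrD cardC card_ffun !card_ord.
  by rewrite natrX.
by field; rewrite !expf_neq0.
Qed.

(** Induction with [(1 - q) (1 + s + q) <= 1 + s]. A divergent sum thus forces the product to 0. *)
Lemma prod_sub1_le (R : realType) (p : nat -> R) i0 I :
  (forall i, 0 <= p i <= 1) ->
  \prod_(i0 <= i < I) (1 - p i) * (1 + \sum_(i0 <= i < I) p i) <= 1.
Proof.
move=> p01; have [|iI] := leqP I i0.
  by move=> Ii; rewrite !big_geq// addr0 mulr1.
elim: I iI => // I IH; rewrite ltnS leq_eqVlt => /orP[/eqP <-|/IH {}IH].
  rewrite !big_nat1; have := p01 i0; nra.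
have [iI|iI] := leqP i0 I; last by rewrite !big_geq// addr0 mulr1.
rewrite !big_nat_recr//=; move: IH.
have : 0 <= \prod_(i0 <= i < I) (1 - p i).
  by apply: prodr_ge0 => i _; have := p01 i; lra.
have : 0 <= \sum_(i0 <= i < I) p i by apply: sumr_ge0 => i _; have /andP[] := p01 i.
move: (\prod_(_ <= _ < _) _) (\sum_(_ <= _ < _) _) => x s s0 x0.
have /andP[p0 p1] := p01 I; move: (p I) p0 p1 => q q0 q1 h.
apply: le_trans h; rewrite -mulrA ler_wpM2l//; nra.
Qed.

(** The second Borel-Cantelli lemma for these blocks: for each [i0], the event that no block from
    [i0] on is good lies in the null set [\bigcap_I E I]. *)
Lemma good_blocks_io (R : realType) b (b0 : (0 < b)%N) (m : nat -> nat)
    (G : forall i, pred {ffun 'I_(m i) -> 'I_b}) (C : R) : 0 < C ->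
  (forall i, C * i.+1%:R^-1 <= #|G i|%:R / b%:R ^+ m i) ->
  {ae unif01 R, forall w : R, forall i0, exists2 i, (i0 <= i)%N &
    G i (digit_word b0 (offset m i) (m i) w)}.
Proof.
move=> C0 HG; apply: ae_foralln => i0.
pose p i : R := #|G i|%:R / b%:R ^+ m i.
have bm0 i : 0 < b%:R ^+ m i :> R by rewrite exprn_gt0// ltr0n.
have p01 i : 0 <= p i <= 1.
  apply/andP; split; first by rewrite divr_ge0// ltW.
  rewrite ler_pdivrMr// mul1r -natrX ler_nat.
  by apply: leq_trans (max_card _) _; rewrite card_ffun !card_ord.
have HA I := @no_good_block R b b0 m G i0 (i0 + I) (leq_addr _ _).
pose E I := [set w : R | (sval (cid (HA I))) (digit_word b0 0 (offset m (i0 + I)) w)].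
have PE I : measurable (E I) /\ unif01 R (E I) = (\prod_(i0 <= i < i0 + I) (1 - p i))%:E.
  have [mE PE] := digit_word_prob R b0 (sval (cid (HA I))).
  by split=> //; rewrite PE; congr EFin; have [_ ->] := svalP (cid (HA I)).
exists (\bigcap_I E I); split.
- by apply: bigcapT_measurable => I; have [] := PE I.
- have mB : measurable (\bigcap_I E I) by apply: bigcapT_measurable => I; have [] := PE I.
  have le I : (unif01 R (\bigcap_I E I) <= (\prod_(i0 <= i < i0 + I) (1 - p i))%:E)%E.
    have [mE <-] := PE I; apply: le_measure; rewrite ?inE//.
    exact: bigcap_inf.
  have fin := fin_num_measure (unif01 R) _ mB.
  suff h : unif01 R (\bigcap_I E I) = 0%E by exact: h.
  rewrite -(fineK fin); congr EFin; apply/eqP; rewrite eq_le.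
  have c0 : 0 <= fine (unif01 R (\bigcap_I E I)) by rewrite fine_ge0.
  rewrite c0 andbT leNgt; apply/negP => c_gt0.
  set c := fine _ in c0 c_gt0.
  have leR I : c <= \prod_(i0 <= i < i0 + I) (1 - p i).
    by rewrite -lee_fin fineK.
  apply: (@dvg_harmonic R).
  apply: nondecreasing_is_cvgn.
    by apply: nondecreasing_series => n _ _; exact: harmonic_ge0.
  (* If that set had probability [c > 0], the sums of [p] would stay below [1 / c], hence the
     harmonic sums below this bound: the first [i0] terms are at most 1 each, the others at most
     [p i / C]. *)
  exists (i0%:R + (C * c)^-1) => _ [n _ <-].
  rewrite /series /=.
  apply: (@le_trans _ _ (\sum_(0 <= i < i0 + n) i.+1%:R^-1)).
    rewrite [leRHS](@big_cat_nat _ _ _ n)//= ?leq_addl// lerDl.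
    by apply: sumr_ge0 => i _; rewrite invr_ge0.
  rewrite (@big_cat_nat _ _ _ i0)//= ?leq_addr//; apply: lerD.
    apply: (@le_trans _ _ (\sum_(0 <= i < i0) 1)).
      by apply: ler_sum => i _; rewrite invf_le1 ?ltr0n// ler1n.
    by rewrite big_const_nat iter_addr_0 subn0.
  rewrite invfM -ler_pdivrMl ?invr_gt0// invrK mulr_sumr.
  apply: (@le_trans _ _ (\sum_(i0 <= i < i0 + n) p i)).
    by apply: ler_sum => i _; exact: HG.
  have h1 := @prod_sub1_le R p i0 (i0 + n) p01.
  have h2 := leR n.
  have s0 : 0 <= \sum_(i0 <= i < i0 + n) p i.
    by apply: sumr_ge0 => i _; have /andP[] := p01 i.
  rewrite -div1r ler_pdivlMr//.
  move: h1 h2 s0; move: (\prod_(_ <= _ < _) _) (\sum_(_ <= _ < _) _) => x s; nra.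
move=> w /= Hw I _ /=; have [HI _] := svalP (cid (HA I)); apply: HI => i /andP[ii0 _].
by apply/negP => Gi; apply: Hw; exists i.
Qed.

(** Some letter occurs at least [s + l / b] times, multiplied by [b] to stay in [nat]. For
    [l = M * s] this is a frequency of at least [1 / b + (1 - 1 / b) / (M + 1)]. *)
Definition biased b s l : pred {ffun 'I_(s + l) -> 'I_b} :=
  fun f => [exists a, (l + b * s <= b * \sum_i (f i == a))%N].

Lemma pigeonhole_letter b l (v : {ffun 'I_l -> 'I_b}) : (0 < b)%N ->
  exists a, (l <= b * \sum_i (v i == a))%N.
Proof.
move=> b0; apply/existsP; rewrite -[X in is_true X]negbK negb_exists.
apply/negP => /forallP H.
have S : (\sum_(a < b) \sum_(i < l) (v i == a) = l)%N.
  rewrite exchange_big /= -[RHS]card_ord -sum1_card; apply: eq_bigr => i _.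
  by rewrite (bigD1 (v i))//= eqxx big1 ?addn0// => a /negbTE; rewrite eq_sym => ->.
have : (\sum_(a < b) (b * \sum_(i < l) (v i == a)).+1 <= \sum_(a < b) l)%N.
  by apply: leq_sum => a _; rewrite ltnNge; exact: H.
under eq_bigr do rewrite -addn1.
rewrite big_split /= -big_distrr /= S !sum_nat_const card_ord; lia.
Qed.

(* Any word of length [l] becomes biased after prepending [s] copies of one of
   its most frequent letters. *)
Lemma card_biased b s l : (0 < b)%N -> (b ^ l <= #|@biased b s l|)%N.
Proof.
move=> b0.
pose c (v : {ffun 'I_l -> 'I_b}) := xchoose (pigeonhole_letter v b0).
pose h (v : {ffun 'I_l -> 'I_b}) : {ffun 'I_(s + l) -> 'I_b} :=
  [ffun i => match fintype.split i with inl _ => c v | inr i => v i end].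
have hl v i : h v (lshift l i) = c v by rewrite ffunE (unsplitK (inl i)).
have hr v i : h v (rshift s i) = v i by rewrite ffunE (unsplitK (inr i)).
have inj : injective h.
  by move=> u v uv; apply/ffunP => i; rewrite -!hr uv.
have <- : #|codom h| = (b ^ l)%N.
  by rewrite card_codom// card_ffun !card_ord.
apply/subset_leq_card/fintype.subsetP => _ /codomP[v ->].
apply/existsP; exists (c v); rewrite big_split_ord /=.
under eq_bigr do rewrite hl eqxx.
under [X in (_ <= _ * (_ + X))%N]eq_bigr do rewrite hr.
rewrite sum1_card card_ord mulnDr addnC leq_add2l.
exact: (xchooseP (pigeonhole_letter v b0)).
Qed.

(** * Periodic repetition of blocks *)

Lemma periodic_sum_ge (v : nat -> nat) m q N : (q * m <= N)%N ->
  (q * \sum_(r < m) v r <= \sum_(t < N) v (t %% m)%N)%N.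
Proof.
move=> qN; apply: (@leq_trans (\sum_(0 <= t < q * m) v (t %% m)%N)%N); last first.
  rewrite -(big_mkord xpredT (fun t => v (t %% m)%N)).
  by rewrite [leqRHS](@big_cat_nat _ _ _ (q * m)) ?leq_addr.
elim: q {qN} => // q IH.
rewrite (@big_cat_nat _ _ _ (q * m))//= ?leq_mul2r ?leqnSn ?orbT// mulSn addnC.
apply: leq_add => //; rewrite -{1}[(q * m)%N]add0n big_addn mulSn addnK big_mkord.
by apply: leq_sum => r _; rewrite addnC modnMDl modn_small.
Qed.

(** The dyadic range is the difference of two initial segments, of lengths [2 ^ (i + 1) - 1] and
    [2 ^ i - 1]; relative errors of [de / 3] on them add up to at most [de * 2 ^ i]. *)
Lemma segment_freq (R : realType) (p : pred nat) (be de : R) :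
  (count p (iota 1 n))%:R / n%:R @[n --> \oo] --> be -> 0 < de ->
  \forall i \near \oo, (count p (iota (2 ^ i) (2 ^ i)))%:R <= (be + de) * (2 ^ i)%:R.
Proof.
move=> /cvgrPdist_le H de0; have d3 : 0 < de / 3 by rewrite divr_gt0.
have [N _ HN] := H _ d3.
have {}HN n : (0 < n)%N -> (N <= n)%N ->
    be * n%:R - de / 3 * n%:R <= (count p (iota 1 n))%:R <= be * n%:R + de / 3 * n%:R.
  move=> n0 Nn; have n0' : 0 < n%:R :> R by rewrite ltr0n.
  have := HN n Nn; rewrite /= ler_norml -mulrBl -mulrDl => /andP[h1 h2].
  rewrite -[X in _ <= X <= _](@divfK _ n%:R) ?gt_eqF// !ler_pM2r//; lra.
exists N.+1 => // i /= Ni.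
have i2 : (i < 2 ^ i)%N by exact: ltn_expl.
have := HN (2 ^ i).-1 ltac:(lia) ltac:(lia).
have := HN ((2 ^ i).-1 + 2 ^ i)%N ltac:(lia) ltac:(lia).
rewrite iotaD add1n prednK; last lia.
rewrite count_cat !natrD.
have -> : (2 ^ i).-1%:R = (2 ^ i)%:R - 1 :> R.
  by apply/eqP; rewrite eq_sym subr_eq natr1 prednK//; lia.
move=> /andP[_ h1] /andP[h2 _]; nra.
Qed.

(** For [b > 1] this is the least [s] with [b ^ s > i + 1]. Then [b ^ - s >= 1 / (b (i + 1))] keeps
    the harmonic series divergent, while a large multiple of [s] still exceeds the window length. *)
Definition stretch b i : nat := (trunc_log b i.+1).+1.

(** Kept as a sum, so that a block has the type required by
    [biased b (stretch b i) (M * stretch b i)]. *)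
Definition period b M i : nat := (stretch b i + M * stretch b i)%N.

(* The digits on [2 ^ i, 2 ^ (i + 1)) repeat with period [period b M i] a block
   of fresh independent digits, stored from position [offset (period b M) i] on. *)
Definition source b M n : nat :=
  let i := trunc_log 2 n in
  (offset (period b M) i + (n - 2 ^ i) %% period b M i)%N.

Lemma period_gt0 b M i : (0 < period b M i)%N.
Proof. by []. Qed.

Lemma period_homo b M : {homo period b M : i j / (i <= j)%N}.
Proof.
move=> i j ij; have : (stretch b i <= stretch b j)%N by exact: leq_trunc_log.
by rewrite /period; nia.
Qed.

Lemma offset_homo m : {homo offset m : i j / (i <= j)%N}.
Proof.
move=> i j; elim: j => [|j IH]; first by rewrite leqn0 => /eqP ->.
by rewrite leq_eqVlt => /orP[/eqP ->//|/IH h]; exact: leq_trans (leq_addr _ _).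
Qed.

(** In one dyadic range, indices with the same source differ by a multiple of the period; different
    ranges read disjoint blocks. *)
Lemma source_inj b M m n : (m < n)%N -> (0 < m)%N ->
  (n - m < period b M (trunc_log 2 m))%N -> source b M m <> source b M n.
Proof.
move=> mn m0 nm; rewrite /source.
have /andP[m1 m2] := trunc_log_bounds (isT : 1 < 2)%N m0.
have /andP[n1 n2] := trunc_log_bounds (isT : 1 < 2)%N (ltn_trans m0 mn).
move: nm m1 m2 n1 n2 (leq_trunc_log 2 (ltnW mn)).
set i := trunc_log 2 m; set j := trunc_log 2 n => nm m1 m2 n1 n2.
rewrite leq_eqVlt => /orP[/eqP ij|ij].
  rewrite -ij => /eqP; rewrite eqn_add2l => /eqP E.
  have : (n - 2 ^ i == m - 2 ^ i %[mod period b M i])%N by rewrite E.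
  rewrite eqn_mod_dvd; last by lia.
  have -> : (n - 2 ^ i - (m - 2 ^ i))%N = (n - m)%N by rewrite -ij in n1; lia.
  move=> /dvdn_leq; lia.
have h1 := ltn_pmod (m - 2 ^ i) (period_gt0 b M i).
have h2 := @offset_homo (period b M) _ _ ij.
rewrite /= in h2; lia.
Qed.

(** With [s = stretch b i], [ln n <= i + 1 <= b ^ s] gives [K ln (ln n) <= K s ln b <= (M - 1) s].
    The rounding costs less than 1, hence less than a further [s]. *)
Lemma period_gt_window (R : realType) b (K : R) n : (1 < b)%N -> 0 < K -> (2 < n)%N ->
  (Num.ceil (K * ln (ln n%:R)) <
    (period b (Num.truncn (K * ln b%:R)).+2 (trunc_log 2 n))%:Z)%R.
Proof.
move=> b1 K0 n2; set M := _.+2.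
have /andP[n1 n3] := trunc_log_bounds (isT : 1 < 2)%N (ltnW (ltnW n2)).
move: n1 n3; set i := trunc_log 2 n => n1 n3.
have b0 : 0 < b%:R :> R by rewrite ltr0n ltnW.
have lnn : ln n%:R <= i.+1%:R :> R.
  apply: (@le_trans _ _ (ln (2 ^+ i.+1))).
    by rewrite ler_ln ?posrE ?exprn_gt0// ?ltr0n ?(ltnW (ltnW n2))// -natrX ler_nat ltnW.
  rewrite lnXn// -[leLHS]mulr_natl ler_piMr//.
  by have := @le_ln1Dx R 1; rewrite -[1 + 1]/(2 : R); apply; rewrite (@lt_trans _ _ 0).
have lnn0 : 0 < ln n%:R :> R by rewrite ln_gt0// ltr1n ltnW.
have lnlnn : ln (ln n%:R) <= (stretch b i)%:R * ln b%:R :> R.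
  apply: (@le_trans _ _ (ln (b%:R ^+ stretch b i))).
    rewrite ler_ln ?posrE ?exprn_gt0//; apply: (le_trans lnn).
    by rewrite -natrX ler_nat ltnW// trunc_log_ltn.
  by rewrite lnXn// -[leLHS]mulr_natl.
have s1 : 1 <= (stretch b i)%:R :> R by rewrite ler1n.
have KM : K * ln b%:R <= M%:R - 1.
  by rewrite /M -[X in _ <= X - 1]natr1 addrK ltW// truncnS_gt.
rewrite -(ltr_int R); apply: (@lt_le_trans _ _ (K * ln (ln n%:R) + 1)).
  by have /andP[h _] := ceil_itv (K * ln (ln n%:R)); rewrite rmorphB /= ltrBlDr in h.
rewrite -[leRHS]/((period b M i)%:R : R) /period natrD natrM.
have : K * ln (ln n%:R) <= K * ((stretch b i)%:R * ln b%:R) by rewrite ler_pM2l.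
have := ler_wpM2r (ltW (lt_le_trans ltr01 s1)) KM.
nra.
Qed.

Lemma biased_not_simply_normal (R : realType) b (b0 : (0 < b)%N) M (w : R) :
  (1 < b)%N ->
  (forall i0, exists2 i, (i0 <= i)%N &
    biased (digit_word b0 (offset (period b M) i) (period b M i) w)) ->
  ~ simply_normal b (number_of_digits R b (fun n => digit b w (source b M n).+1)).
Proof.
move=> b1 io nx; pose x n := digit b w (source b M n).+1.
have xb j : (0 < j)%N -> (x j < b)%N by move=> _; exact: digit_lt.
have SN a := @simply_normal_digits R b x a b1 xb nx.
(* After multiplication by [b (M + 1) / 2 ^ i], this error is [1 / 4] and the incomplete last period
   costs at most [1 / 2]; together they are less than the bias [b - 1 >= 1]. *)
pose de : R := (4 * b%:R * M.+1%:R)^-1.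
have b0' : 0 < b%:R :> R by rewrite ltr0n.
have de0 : 0 < de by rewrite invr_gt0 !mulr_gt0// ltr0n.
(* The frequent letter depends on [i], so the bound must hold for all letters from a common index
   on. *)
have F : \forall i \near \oo, forall a : 'I_b,
    (count (fun n => x n == a) (iota (2 ^ i) (2 ^ i)))%:R <= (b%:R^-1 + de) * (2 ^ i)%:R.
  by apply: filter_forall => a; apply: segment_freq => //; exact: SN.
have [N1 _ H1] := F.
have half : 0 < 2^-1 :> R by rewrite invr_gt0.
(* The period is at most [2 (M + 1) (i + 1)], so an incomplete one is negligible against [2 ^ i]. *)
have [N2 _ H2] := linear_le_exp2 (2 * M.+1%:R * (M%:R + b%:R)) half.
have [i Ni /existsP[a Ha]] := io (maxn N1 N2).
have {H1} := H1 i ltac:(rewrite /=; lia) a.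
have {H2} := H2 i ltac:(rewrite /=; lia).
set s := stretch b i in Ha.
have s0 : (0 < s)%N by [].
have si : (s <= i.+2)%N.
  rewrite ltnS; have := @trunc_logP b i.+1 b1 isT.
  by have := ltn_expl (trunc_log b i.+1) b1; lia.
set m := period b M i in Ha *.
have mE : m = (M.+1 * s)%N by [].
pose v r := (digit b w (offset (period b M) i + r).+1 == a) : nat.
have vE : (\sum_(r < m) v r =
    \sum_(r < m) (digit_word b0 (offset (period b M) i) m w r == a))%N.
  by apply: eq_bigr => r _; rewrite /v ffunE -val_eqE.
have cE : count (fun n => x n == a) (iota (2 ^ i) (2 ^ i)) =
     (\sum_(t < 2 ^ i) v (t %% m))%N.
  rewrite -sum1_count -[X in iota X _]addn0 iotaDl big_map big_mkcond /=.
  rewrite -[X in iota 0 X]subn0 -[iota _ _]/(index_iota 0 (2 ^ i)) big_mkord.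
  apply: eq_bigr => t _; rewrite /x /source.
  have -> : trunc_log 2 (2 ^ i + t) = i.
    by apply: trunc_log_eq => //; rewrite leq_addr expnS; have := ltn_ord t; lia.
  by rewrite addKn /v -/m; case: eqP.
have := @periodic_sum_ge v m (2 ^ i %/ m) (2 ^ i) (leq_trunc_div _ _).
rewrite -cE vE; set S := (\sum_(r < m) _)%N; rewrite -/S in Ha.
set c := count _ _ => hc.
have m0 : (0 < m)%N by rewrite mE; lia.
have hd : (2 ^ i < (2 ^ i %/ m).+1 * m)%N by exact: ltn_ceil.
(* The [2 ^ i %/ m] complete periods contain the letter at least [s (M + b) / b] times each, and
   fewer than [m] positions remain. *)
have key : (2 ^ i * (M + b) <= b * c * M.+1 + m * (M + b))%N.
  set D := (2 ^ i %/ m)%N in hc hd.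
  have h1 : (D * (s * (M + b)) <= b * c)%N.
    apply: (@leq_trans (D * (b * S))%N).
      by rewrite leq_mul2l; apply/orP; right; move: Ha; nia.
    by rewrite mulnCA leq_mul2l hc orbT.
  have h2 : (D * m * (M + b) <= b * c * M.+1)%N.
    by rewrite mE; move: h1; nia.
  have h3 : (2 ^ i * (M + b) <= (D * m + m) * (M + b))%N.
    by rewrite leq_mul2r; apply/orP; right; move: hd; lia.
  by move: h3; rewrite mulnDl; lia.
have mR : m%:R <= M.+1%:R * (2 * i.+1%:R) :> R.
  by rewrite -!natrM ler_nat mE leq_mul2l; apply/orP; right; lia.
have {}key : (2 ^ i)%:R * (M%:R + b%:R) <=
     b%:R * c%:R * M.+1%:R + m%:R * (M%:R + b%:R) :> R.
  by rewrite -!natrD -!natrM -natrD ler_nat.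
have P0 : 0 < (2 ^ i)%:R :> R by rewrite ltr0n expn_gt0.
have b2 : 2 <= b%:R :> R by rewrite ler_nat.
have M0 : 0 <= M%:R :> R by [].
move=> h2 h1.
have e1 : b%:R * c%:R * M.+1%:R <= (M%:R + 1 + 4^-1) * (2 ^ i)%:R :> R.
  apply: (@le_trans _ _ (b%:R * ((b%:R^-1 + de) * (2 ^ i)%:R) * M.+1%:R)).
    by rewrite ler_wpM2r// ler_wpM2l// ltW.
  rewrite le_eqVlt; apply/orP; left; apply/eqP; rewrite /de -natr1; field.
  by apply/andP; split; rewrite gt_eqF//; lra.
have e2 : m%:R * (M%:R + b%:R) <= 2^-1 * (2 ^ i)%:R :> R.
  apply: le_trans h2; rewrite mulrAC ler_wpM2r ?addr_ge0//.
  by rewrite mulrAC mulrC; move: mR; lra.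
nra.
Qed.

Lemma ex_independent_windows_not_normal (R : realType) b (K : R) : (1 < b)%N -> 0 < K ->
  exists (d : measure_display) (T : measurableType d) (P : probability T R)
     (X : nat -> {RV P >-> nat}),
     [/\ (forall n w, (1 <= n)%N -> (X n w < b)%N),
         (forall n, (1 <= n)%N -> uniform_digit b (X n)),
         (\forall n \near \oo,
            mutually_independent (window n (K * ln (ln n%:R))) X)
       & {ae P, forall w,
            ~ simply_normal b (number_of_digits R b (fun j => X j w))}].
Proof.
move=> b1 K0; have b0 := ltnW b1.
pose M := (Num.truncn (K * ln b%:R)).+2.
exists _, (measurableTypeR R), (unif01 R), (fun n => digit_fun b (source b M n).+1).
split.
- by move=> n w _; exact: digit_lt.
- by move=> n _; exact: uniform_digit_fun.
- exists 3%N => // n /= n3; apply: mutually_independent_digits => //.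
  have P := period_gt_window b1 K0 n3.
  (* Two indices of the window differ by less than the period at [n], and the period at [p >= n] is
     at least as long. *)
  have lt p q : window n (K * ln (ln n%:R)) p -> window n (K * ln (ln n%:R)) q ->
      (p < q)%N -> source b M p <> source b M q.
    move=> [np _] [_ qn] pq; apply: source_inj => //; first lia.
    apply: leq_trans (period_homo _ _ (leq_trunc_log 2 np)).
    rewrite -/M in P; lia.
  move=> p q wp wq E; case: (ltngtP p q) => // pq; exfalso.
    exact: (lt p q).
  exact: (lt q p).
have C0 : 0 < (b%:R^-1 : R) by rewrite invr_gt0 ltr0n.
have := @good_blocks_io R b b0 (period b M)
  (fun i => @biased b (stretch b i) (M * stretch b i)) _ C0.
have H i : b%:R^-1 * i.+1%:R^-1 <=
    #|@biased b (stretch b i) (M * stretch b i)|%:R / b%:R ^+ period b M i :> R.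
  have b0' : 0 < b%:R :> R by rewrite ltr0n.
  (* At least [b ^ (M s)] of the [b ^ (s + M s)] words are biased, where [s = stretch b i], and
     [b ^ s <= b (i + 1)]. *)
  apply: (@le_trans _ _ ((b%:R ^+ stretch b i)^-1)).
    rewrite -invfM lef_pV2 ?posrE ?exprn_gt0 ?mulr_gt0 ?ltr0n//.
    rewrite -natrX -natrM ler_nat expnS leq_mul2l trunc_logP ?orbT//.
  rewrite ler_pdivlMr ?exprn_gt0// /period exprD mulKf ?expf_neq0 ?gt_eqF//.
  by rewrite -natrX ler_nat card_biased.
move=> /(_ H); apply: (@negligibleS _ _ _ (unif01 R)); apply: subsetC => w io.
exact: (@biased_not_simply_normal R b b0 M w b1 io).
Qed.

Theorem theorem3 (R : realType) :
  (forall (b : nat), (2 <= b)%N ->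
   forall (d : measure_display) (T : measurableType d) (P : probability T R)
     (X : nat -> {RV P >-> nat}),
     (forall n w, (1 <= n)%N -> (X n w < b)%N) ->
     (forall n, (1 <= n)%N -> uniform_digit b (X n)) ->
     (exists g : nat -> R,
        [/\ {homo g : m n / (m <= n)%N >-> m <= n},
            g n @[n --> \oo] --> +oo
          & \forall n \near \oo,
              mutually_independent (window n (g n * ln (ln n%:R))) X]) ->
     {ae P, forall w, normal_number b (number_of_digits R b (fun j => X j w))})
  /\
  (forall (b : nat), (2 <= b)%N ->
   forall K : R, 0 < K ->
   exists (d : measure_display) (T : measurableType d) (P : probability T R)
     (X : nat -> {RV P >-> nat}),
     [/\ (forall n w, (1 <= n)%N -> (X n w < b)%N),
         (forall n, (1 <= n)%N -> uniform_digit b (X n)),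
         (\forall n \near \oo,
            mutually_independent (window n (K * ln (ln n%:R))) X)
       & {ae P, forall w,
            ~ simply_normal b (number_of_digits R b (fun j => X j w))}]).
Proof.
split=> [b b1 d T P X Xb uX [g [_ goo indX]]|b b1 K K0].
  exact: ae_normal_number b1 Xb uX goo indX.
exact: ex_independent_windows_not_normal.
Qed.
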